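(* Let $\Omega\subset\mathbb{R}^d$ be a compact, full-dimensional, semianalytic set, let $g:\Omega\to\mathbb{R}$ and $\varphi:\Omega\to\mathbb{R}$ be real analytic and positive, and let $f(\omega)=\omega_1^{\kappa_1}\cdots\omega_d^{\kappa_d}\,g(\omega)$, where the $\kappa_i$ are nonnegative integers. Suppose that $$\tfrac1\ell=\kappa_1=\cdots=\kappa_m>\kappa_{m+1}\ge\cdots\ge\kappa_d$$ for some $1\le m\le d$ (so $\kappa_1\ge1$), and that the boundary of $\Omega$ is transversal to the subspace $L$ defined by $\omega_1=\cdots=\omega_m=0$. Write $\bar\omega=(\omega_{m+1},\dots,\omega_d)$ and $\bar\kappa=(\kappa_{m+1},\dots,\kappa_d)$. Then $$V(\lambda):=\int_{\{\omega\in\Omega:|f(\omega)|\le\lambda\}}\varphi(\omega)\,d\omega\;\approx\;C\,\lambda^{\ell}(-\ln\lambda)^{m-1}$$ asymptotically as $\lambda\to0^+$, where $$C=\frac{(2\ell)^m}{\ell\,(m-1)!}\int_{\Omega\cap L}|\bar\omega|^{-\ell\bar\kappa}\;g(0,\dots,0,\bar\omega)^{-\ell}\;\varphi(0,\dots,0,\bar\omega)\,d\bar\omega,\qquad |\bar\omega|^{-\ell\bar\kappa}:=\prod_{i=m+1}^d|\omega_i|^{-\ell\kappa_i}.$$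
   Context: All measures are standard Lebesgue measures; if $m=d$ then $L=\{0\}$ and the integral over $\Omega\cap L$ means evaluation of the integrand at the origin (and is $0$ if $0\notin\Omega$). Real analytic on $\Omega$ means analytic on an open neighborhood of $\Omega$. The boundary of $\Omega$ is transversal to $L$ if, at every point of their intersection, the boundary is smooth (a smooth hypersurface of $\mathbb{R}^d$ near that point) and its tangent space together with $L$ generates the tangent space $\mathbb{R}^d$. The notation $V(\lambda)\approx C\lambda^\ell(-\ln\lambda)^{m-1}$ means $V(\lambda)=C\lambda^\ell(-\ln\lambda)^{m-1}+o(\lambda^\ell(-\ln\lambda)^{m-1})$ as $\lambda\to0^+$. *)

(* Defs.v *)
From HB Require Import structures.
From mathcomp Require Import all_boot all_order all_algebra finmap.
From mathcomp Require Import all_classical all_reals all_analysis.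
From mathcomp Require summability.

Set Implicit Arguments.
Unset Strict Implicit.
Unset Printing Implicit Defensive.

Import Order.TTheory GRing.Theory Num.Theory.
Import numFieldNormedType.Exports.

Local Open Scope classical_set_scope.
Local Open Scope ring_scope.

(* Row vectors carry the sigma-algebra generated by the coordinates, as
   n.-tuple T does in the library. For T = R it is the Borel sigma-algebra. *)
Definition measure_rV_display : measure_display -> measure_display.
Proof. exact. Qed.

Section measurable_rV.
Context {d} {T : sigmaRingType d}.
Variable n : nat.

Let coors : 'I_n -> 'rV[T]_n -> T := fun i v => v ord0 i.

Let rV_set0 : g_sigma_preimage coors set0.
Proof. exact: sigma_algebra0. Qed.

Let rV_setC A : g_sigma_preimage coors A -> g_sigma_preimage coors (~` A).
Proof. exact: sigma_algebraC. Qed.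

Let rV_bigcup (F : _^nat) : (forall i, g_sigma_preimage coors (F i)) ->
  g_sigma_preimage coors (\bigcup_i (F i)).
Proof. exact: sigma_algebra_bigcup. Qed.

HB.instance Definition _ := @isMeasurable.Build (measure_rV_display d)
  'rV[T]_n (g_sigma_preimage coors) rV_set0 rV_setC rV_bigcup.

End measurable_rV.

Lemma measurable_coord d (T : measurableType d) n (i : 'I_n) :
  measurable_fun [set: 'rV[T]_n] (fun v => v ord0 i).
Proof.
move=> _ Y mY; rewrite setTI; apply: sub_sigma_algebra => /=.
rewrite -bigcup_seq/=; exists i => /=; first by rewrite mem_index_enum.
by exists Y => //; rewrite setTI.
Qed.

Lemma measurable_fun_rV d1 d2 (T1 : measurableType d1) (T2 : measurableType d2)
    n (f : T1 -> 'rV[T2]_n) :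
  (forall i, measurable_fun [set: T1] (fun x => f x ord0 i)) ->
  measurable_fun [set: T1] f.
Proof.
move=> mf _ A mA; rewrite setTI.
suff : g_sigma_preimage (fun i (v : 'rV[T2]_n) => v ord0 i)
    `<=` [set B | measurable (f @^-1` B)] by exact.
apply: smallest_sub.
  split=> [|B mB|F mF] /=.
  - by rewrite preimage_set0; exact: measurable0.
  - by rewrite setTD preimage_setC; exact: measurableC.
  - by rewrite preimage_bigcup; exact: bigcupT_measurable.
move=> B /=; rewrite -bigcup_seq/= => -[i _ [C mC <-]].
by rewrite setTI -comp_preimage -[X in measurable X]setTI; exact: mf.
Qed.

Section lebesgue_rV.
Context {R : realType}.

Definition cons_rV n (p : R * 'rV[R]_n) : 'rV[R]_n.+1 :=
  row_mx (p.1)%:M p.2.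

Definition uncons_rV n (v : 'rV[R]_n.+1) : R * 'rV[R]_n :=
  (v ord0 ord0, \row_i v ord0 (lift ord0 i)).

Lemma cons_rVK n : cancel (@cons_rV n) (@uncons_rV n).
Proof.
move=> [x v]; rewrite /cons_rV /uncons_rV /=; congr pair.
  rewrite -[RHS](_ : row_mx x%:M v ord0 (@lshift 1 n ord0) = x).
    by congr (_ _ _); exact/val_inj.
  by rewrite (@row_mxEl _ 1 1 n) mxE.
apply/rowP => i; rewrite mxE -(@row_mxEr _ 1 1 n x%:M v).
by congr (_ _ _); exact/val_inj.
Qed.

Lemma uncons_rVK n : cancel (@uncons_rV n) (@cons_rV n).
Proof.
move=> v; apply/rowP => i; rewrite /cons_rV /uncons_rV /=.
have [j ->|j ->] := @split_ordP 1 n i.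
  rewrite (@row_mxEl _ 1 1 n) !mxE (ord1 j) mulr1n.
  by congr (v _ _); exact/val_inj.
by rewrite (@row_mxEr _ 1 1 n) mxE; congr (v _ _); exact/val_inj.
Qed.

Lemma measurable_cons_rV n :
  measurable_fun [set: (measurableTypeR R * 'rV[R]_n)%type] (@cons_rV n).
Proof.
apply: measurable_fun_rV => i; have [j ->|j ->] := @split_ordP 1 n i.
  under eq_fun do rewrite (@row_mxEl _ 1 1 n) (ord1 j) mxE mulr1n.
  exact: measurable_fst.
under eq_fun do rewrite (@row_mxEr _ 1 1 n).
by apply: (measurableT_comp (measurable_coord j)); exact: measurable_snd.
Qed.

Lemma measurable_uncons_rV n :
  measurable_fun [set: 'rV[R]_n.+1]
    (@uncons_rV n : _ -> measurableTypeR R * 'rV[R]_n)%type.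
Proof.
apply: measurable_fun_pair => /=; first exact: measurable_coord.
apply: measurable_fun_rV => i; under eq_fun do rewrite mxE.
exact: measurable_coord.
Qed.

(* Lebesgue measure on R^n as an iterated product; on R^0 it is the unit mass at
   the only point. *)
Fixpoint lebesgue_rV n : set 'rV[R]_n -> \bar R :=
  if n is n'.+1 then
    pushforward (@lebesgue_measure R \x @lebesgue_rV n')%E (@cons_rV n')
  else \d_(0 : 'rV[R]_0).

Let lebesgue_rV_measure n :
  exists nu : {sigma_finite_measure set 'rV[R]_n -> \bar R},
    nu = @lebesgue_rV n :> (_ -> _).
Proof.
elim: n => [|n [nu nuE]].
  by exists (\d_(0 : 'rV[R]_0)).
rewrite /= -nuE; pose m := (@lebesgue_measure R \x nu)%E; rewrite -/m.
set f := @cons_rV n.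
have mf : measurable_fun setT f by exact: measurable_cons_rV.
unshelve epose (mu := (pushforward m f : {measure set _ -> \bar R})).
  exact: mf.
have sf : sigma_finite setT mu.
  have /sigma_finiteP[F [TF ndF Foo]] := sigma_finiteT (@lebesgue_measure R).
  have /sigma_finiteP[G [TG ndG Goo]] := sigma_finiteT nu.
  exists (fun k => (@uncons_rV n) @^-1` (F k `*` G k)).
    rewrite -preimage_bigcup; apply/esym/seteqP; split => // v _ /=.
    have [i _ Fi] : (\bigcup_i F i) (uncons_rV v).1 by rewrite -TF.
    have [j _ Gj] : (\bigcup_i G i) (uncons_rV v).2 by rewrite -TG.
    exists (maxn i j) => //; split.
      by move: Fi; exact/subsetPset/ndF/leq_maxl.
    by move: Gj; exact/subsetPset/ndG/leq_maxr.
  move=> k; have [? ?] := Foo k; have [? ?] := Goo k; split.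
    rewrite -[X in measurable X]setTI; apply: measurable_uncons_rV => //.
    exact: measurableX.
  rewrite /= /pushforward -comp_preimage.
  rewrite (_ : _ \o _ = id); last by apply/funext => p; exact: cons_rVK.
  by rewrite /m product_measure1E// lte_mul_pinfty// ge0_fin_numE.
pose mu' : {sigma_finite_measure set _ -> \bar R} :=
  HB.pack (pushforward m f) mu (Measure_isSigmaFinite.Build _ _ _ mu sf).
by exists (mu' mf).
Qed.

Let lebesgue_rV0 n : @lebesgue_rV n set0 = 0%E.
Proof. by have [nu <-] := lebesgue_rV_measure n; rewrite measure0. Qed.

Let lebesgue_rV_ge0 n A : (0 <= @lebesgue_rV n A)%E.
Proof. by have [nu <-] := lebesgue_rV_measure n; exact: measure_ge0. Qed.

Let lebesgue_rV_sigma_additive n : semi_sigma_additive (@lebesgue_rV n).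
Proof.
by have [nu <-] := lebesgue_rV_measure n; exact: measure_semi_sigma_additive.
Qed.

HB.instance Definition _ n := isMeasure.Build _ _ _ (@lebesgue_rV n)
  (lebesgue_rV0 n) (@lebesgue_rV_ge0 n) (@lebesgue_rV_sigma_additive n).

Let lebesgue_rV_sigma_finite n : sigma_finite setT (@lebesgue_rV n).
Proof. by have [nu <-] := lebesgue_rV_measure n; exact: sigma_finiteT. Qed.

HB.instance Definition _ n := Measure_isSigmaFinite.Build _ _ _
  (@lebesgue_rV n) (@lebesgue_rV_sigma_finite n).

End lebesgue_rV.
Arguments lebesgue_rV {R} n A.

Section real_analytic.
Context {R : realType} {d : nat}.
Implicit Types (f h : 'rV[R]_d -> R) (A M U : set 'rV[R]_d).

(* Convergence along the net of finite sets of multi-indices amounts to absolute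
   convergence of the power series. *)
Definition analytic_at f (a : 'rV[R]_d) :=
  exists (c : {ffun 'I_d -> nat} -> R) (r : R), 0 < r /\
    forall x : 'rV[R]_d, (forall i, `|x ord0 i - a ord0 i| < r) ->
      summability.partial_sum
        (fun alpha : {ffun 'I_d -> nat} =>
           c alpha * \prod_i (x ord0 i - a ord0 i) ^+ alpha i)
        @ summability.totally --> f x.

(* Only the values of f on A matter. *)
Definition real_analytic_on A f := exists U F,
  [/\ open U, A `<=` U, forall x, U x -> analytic_at F x
    & forall x, A x -> F x = f x].

Definition semianalytic A := forall a : 'rV[R]_d, exists U,
  [/\ open U, U a &
    exists (p q : nat) (h : 'I_p -> 'I_q -> 'rV[R]_d -> R)
        (is_eq : 'I_p -> 'I_q -> bool),
      (forall i j x, U x -> analytic_at (h i j) x) /\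
      (forall x, U x -> A x <->
         exists i, forall j,
           if is_eq i j then h i j x = 0 else 0 < h i j x)].

Definition boundary A := closure A `\` A°.

Fixpoint Ck (k : nat) U f : Prop :=
  if k is k'.+1 then
    (forall x, U x -> differentiable f x) /\
    (forall i : 'I_d, Ck k' U (fun x => 'D_(delta_mx ord0 i) f x))
  else forall x, U x -> {for x, continuous f}.

Definition smooth_on U f := forall k, Ck k U f.

(* Near p, the set M is the zero set of a smooth submersion h, and T is the
   tangent space of M at p. *)
Definition smooth_hypersurface_at M (p : 'rV[R]_d) (T : set 'rV[R]_d) :=
  exists U h,
    [/\ open U, U p, smooth_on U h,
        forall x, U x -> exists v, 'd h x v != 0
      & M `&` U = [set x | h x = 0] `&` U] /\
    T = [set v | 'd h p v = 0].

Definition boundary_transversal A (L : set 'rV[R]_d) :=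
  forall p, boundary A p -> L p ->
    exists2 T, smooth_hypersurface_at (boundary A) p T &
      forall v, exists t l, [/\ T t, L l & v = t + l].

End real_analytic.

(* R^(m + n) = R^m x R^n; the subspace where the first m coordinates vanish. *)
Definition first_coords0 {R : realType} (m n : nat) : set 'rV[R]_(m + n) :=
  [set w | forall i : 'I_m, w ord0 (lshift n i) = 0].
Arguments first_coords0 {R} m n _.

(* Main.v *)
(* Write w = (x, y) with x in R^m and y in R^n. For fixed y off the coordinate
   hyperplanes, |f(x, y)| <= lambda means |x_1 ... x_m| <= theta(x) lambda^ell
   with theta(x) = prod_j |y_j|^(-ell kappa_j) g(x, y)^(-ell). The volume of
   {|x_i| <= B, |x_1 ... x_m| <= t} is the explicit function
   2^m t sum_(k < m) ln(B^m / t)^k / k!, whose leading term does not depend on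
   B; so only arbitrarily small x matter, and the normalized integral over the
   fiber above y tends to a constant times theta(0) phi(0, y) whenever (0, y) is
   not on the boundary. These y form a conull set: by transversality the excluded
   set is locally the zero set of a function with a nonzero partial derivative,
   hence meets parallel lines at most once. The normalized fiber integrals are
   dominated by a multiple of prod_j |y_j|^(-ell kappa_j), integrable because
   ell kappa_j < 1, and dominated convergence gives the asymptotics. *)
Require Import Defs.
From mathcomp Require Import all_boot all_order all_algebra finmap.
From mathcomp Require Import all_classical all_reals all_analysis.
From mathcomp Require Import measurable_realfun ring lra.
From mathcomp Require summability.

Set Implicit Arguments.
Unset Strict Implicit.
Unset Printing Implicit Defensive.

Import Order.TTheory GRing.Theory Num.Theory.
Import numFieldNormedType.Exports.

Local Open Scope classical_set_scope.
Local Open Scope ring_scope.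

(** The logarithms never spoil the domination: near the coordinate hyperplanes of the y-space the
    factor prod_j |y_j|^(-ell kappa_j) blows up, but it enters ln (B^m / t) with a minus sign. So
    the logarithm is bounded by a multiple of -ln lambda uniformly in y, and only the linear factor
    t contributes a singularity. In x, continuity is needed at x = 0 alone. The functions g^(-ell)
    and phi are therefore extended by zero off [Omega]; the extensions are continuous at (0, y) as
    soon as (0, y) is off the boundary, and the shape of the fiber disappears from the estimates.
    The fiber problem is solved in s = lambda^ell, with constant 2^m / (m-1)!; returning to lambda
    replaces ln s by ell ln lambda and brings the factor ell^(m-1), whence (2 ell)^m / (ell (m-1)!).
    From the asymptotics on, the code writes [m.+1] for the number of leading coordinates, so that
    the exponent of the logarithm is [m]. *)

(** * Fubini for row vectors *)

Section fubini.
Context {R : realType}.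

Lemma measurable_fun_row_mx m n :
  measurable_fun [set: ('rV[R]_m * 'rV[R]_n)%type]
    (fun p => row_mx p.1 p.2 : 'rV[R]_(m + n)).
Proof.
apply: measurable_fun_rV => i; case: (split_ordP i) => j ->.
  under eq_fun do rewrite row_mxEl.
  exact: (measurableT_comp (measurable_coord j)).
under eq_fun do rewrite row_mxEr.
exact: (measurableT_comp (measurable_coord j)).
Qed.

Lemma ge0_integral_cons_rV n (u : 'rV[R]_n.+1 -> \bar R) :
  measurable_fun [set: 'rV[R]_n.+1] u -> (forall w, (0 <= u w)%E) ->
  (\int[lebesgue_rV n.+1]_w u w =
   \int[lebesgue_measure]_x \int[lebesgue_rV n]_v u (cons_rV (x, v)))%E.
Proof.
move=> mu u0.
rewrite [lebesgue_rV n.+1]/=.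
have mc := @measurable_cons_rV R n.
rewrite (ge0_integral_pushforward mc)//.
rewrite preimage_setT fubini_tonelli1//.
- exact: measurableT_comp.
- by move=> x; exact: u0.
Qed.

Lemma cons_rV0 n (x : R) (v : 'rV[R]_n) : cons_rV (x, v) ord0 ord0 = x.
Proof. by have /(congr1 fst) := cons_rVK (x, v). Qed.

Lemma cons_rVS n (x : R) (v : 'rV[R]_n) i :
  cons_rV (x, v) ord0 (lift ord0 i) = v ord0 i.
Proof. by have /(congr1 snd)/rowP/(_ i) := cons_rVK (x, v); rewrite mxE. Qed.

Lemma row_mx_cons_rV m n (x : R) (u : 'rV[R]_m) (v : 'rV[R]_n) :
  row_mx (cons_rV (x, u)) v = cons_rV (x, row_mx u v) :> 'rV[R]_(m.+1 + n).
Proof.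
apply/rowP => i; have [j ->|->] := unliftP (ord0 : 'I_(m + n).+1) i.
  rewrite cons_rVS; case: (split_ordP j) => k ->.
    have -> : lift ord0 (lshift n k) = lshift n (lift ord0 k) :> 'I_(m.+1 + n).
      exact: val_inj.
    by rewrite !row_mxEl cons_rVS.
  have -> : lift ord0 (rshift m k) = rshift m.+1 k :> 'I_(m.+1 + n).
    exact: val_inj.
  by rewrite !row_mxEr.
rewrite cons_rV0.
have -> : ord0 = lshift n ord0 :> 'I_(m.+1 + n) by exact: val_inj.
by rewrite row_mxEl cons_rV0.
Qed.

(** Splitting off one coordinate at a time follows the recursion that defines the measure; the base
    case integrates against the unit mass on R^0. *)
Lemma ge0_integral_row_mx m n (u : 'rV[R]_(m + n) -> \bar R) :
  measurable_fun [set: 'rV[R]_(m + n)] u -> (forall w, (0 <= u w)%E) ->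
  (\int[lebesgue_rV (m + n)]_w u w =
   \int[lebesgue_rV m]_x \int[lebesgue_rV n]_y u (row_mx x y))%E.
Proof.
elim: m u => [|m IH] u mu u0.
  rewrite [RHS](_ : _ = \int[\d_(0%R : 'rV[R]_0)]_x
      \int[lebesgue_rV n]_y u (row_mx x y))%E//.
  rewrite integral_dirac//; last first.
    have -> : (fun x : 'rV[R]_0 => \int[lebesgue_rV n]_y u (row_mx x y))%E =
        cst (\int[lebesgue_rV n]_y u (row_mx (0%R : 'rV[R]_0) y))%E.
      by apply/funext => x; rewrite thinmx0.
    exact: measurable_cst.
  by rewrite diracT mul1e; apply: eq_integral => y _; rewrite row_thin_mx.
rewrite (@ge0_integral_cons_rV (m + n))//.
rewrite (@ge0_integral_cons_rV m)//; last 2 first.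
- apply: (@measurable_fun_fubini_tonelli_F _ _ _ _ _ (lebesgue_rV n)
    (fun p : 'rV[R]_m.+1 * 'rV[R]_n => u (row_mx p.1 p.2))) => //.
  exact: (measurableT_comp mu (@measurable_fun_row_mx m.+1 n)).
- by move=> x; exact: integral_ge0.
apply: eq_integral => x _.
have mcx : measurable_fun [set: 'rV[R]_(m + n)] (fun w => u (cons_rV (x, w))).
  apply: (measurableT_comp mu).
  apply: (measurableT_comp (@measurable_cons_rV R (m + n))).
  exact: measurable_pair1.
rewrite (IH _ mcx); last by move=> w; exact: u0.
by apply: eq_integral => v _; apply: eq_integral => y _; rewrite row_mx_cons_rV.
Qed.

(** This order, with y outermost, is the one needed to treat the fibers over fixed y. *)
Lemma ge0_integral_row_mx2 m n (u : 'rV[R]_(m + n) -> \bar R) :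
  measurable_fun [set: 'rV[R]_(m + n)] u -> (forall w, (0 <= u w)%E) ->
  (\int[lebesgue_rV (m + n)]_w u w =
   \int[lebesgue_rV n]_y \int[lebesgue_rV m]_x u (row_mx x y))%E.
Proof.
move=> mu u0; rewrite ge0_integral_row_mx//.
rewrite (@fubini_tonelli _ _ 'rV[R]_m 'rV[R]_n R (lebesgue_rV m) (lebesgue_rV n)
  (fun p => u (row_mx p.1 p.2)))//.
exact: (measurableT_comp mu (@measurable_fun_row_mx m n)).
Qed.

Lemma lebesgue_rV_consE n (X : set 'rV[R]_n.+1) :
  (lebesgue_rV n.+1 X =
   \int[lebesgue_measure]_s lebesgue_rV n [set v | X (cons_rV (s, v))])%E.
Proof.
rewrite /= /pushforward /product_measure1; apply: eq_integral => s _ /=.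
by congr (lebesgue_rV n _); apply/seteqP; split => v /=; rewrite /xsection/= inE.
Qed.

Lemma measurable_cons_slice n (X : set 'rV[R]_n.+1) (s : R) : measurable X ->
  measurable [set v : 'rV[R]_n | X (cons_rV (s, v))].
Proof.
move=> mX; rewrite -[X in measurable X]setTI.
exact: (measurableT_comp (@measurable_cons_rV R n)).
Qed.

Lemma measurable_fun_cons_slice n (X : set 'rV[R]_n.+1) : measurable X ->
  measurable_fun [set: measurableTypeR R]
    (fun s => lebesgue_rV n [set v : 'rV[R]_n | X (cons_rV (s, v))]).
Proof.
move=> mX.
have mX' : measurable ((@cons_rV R n) @^-1` X : set (measurableTypeR R * 'rV[R]_n)).
  by rewrite -[X in measurable X]setTI; exact: measurable_cons_rV.
have := @measurable_fun_xsection _ _ _ _ _ (lebesgue_rV n) _ mX'.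
apply: eq_measurable_fun => s _ /=.
by congr (lebesgue_rV n _); apply/seteqP; split => v /=; rewrite /xsection/= inE.
Qed.

End fubini.

(** * Borel sets *)

Section topo.
Context {R : realType}.

Lemma nbhs_rVP n (x : 'rV[R]_n) (A : set 'rV[R]_n) :
  nbhs x A <-> exists2 e : R, 0 < e &
    forall y : 'rV[R]_n, (forall i, `|y ord0 i - x ord0 i| < e) -> A y.
Proof.
split.
  move/nbhs_ballP => [e /= e0 xA]; exists e => // y yx; apply: xA; split=> // i j.
  by rewrite (ord1 i) /ball/= distrC.
move=> [e e0 xA]; apply/nbhs_ballP; exists e => //= y [_ yx].
by apply: xA => i; rewrite distrC; exact: yx.
Qed.

(** A countable family of cubes that contains arbitrarily small neighborhoods of every point. It
    gives the measurability of open sets, and later reduces nullity to a local question. *)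
Definition rat_box n (q : 'rV[rat]_n * rat) : set 'rV[R]_n :=
  [set x | forall i, `|x ord0 i - ratr (q.1 ord0 i)| < ratr q.2].

Lemma measurable_rat_box n q : measurable (@rat_box n q).
Proof.
have -> : rat_box q =
    \bigcap_(i in [set` 'I_n])
      ((fun x : 'rV[R]_n => x ord0 i) @^-1` ball (ratr (q.1 ord0 i) : R) (ratr q.2)).
  apply/seteqP; split => x /= h i; first by move=> _; rewrite /ball/= distrC.
  by have /= := h i erefl; rewrite /ball/= distrC.
apply: fin_bigcap_measurable => // i _.
rewrite -[X in measurable X]setTI; apply: measurable_coord => //.
exact: measurable_ball.
Qed.

Lemma rat_box_nbhs n (x : 'rV[R]_n) (e : R) : 0 < e ->
  exists2 q, rat_box q x &
   forall y, rat_box q y -> forall i, `|y ord0 i - x ord0 i| < e.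
Proof.
move=> e0.
have [r /andP[r0 re]] : exists r : rat, 0 < (ratr r : R) < e / 2.
  have [r rP] := @rat_in_itvoo R 0 (e / 2) (divr_gt0 e0 (ltr0n _ 2)).
  by exists r; move: rP; rewrite in_itv.
have [q hq] : exists q : 'I_n -> rat, forall i, `|x ord0 i - ratr (q i)| < (ratr r : R).
  suff : forall i, exists q : rat, `|x ord0 i - ratr q| < (ratr r : R).
    by move=> /choice[q hq]; exists q.
  move=> i; have [q] := @rat_in_itvoo R (x ord0 i - ratr r) (x ord0 i)
    (ltac:(by rewrite ltrBlDr ltrDl)).
  rewrite in_itv/= => /andP[q1 q2]; exists q.
  by rewrite gtr0_norm ?subr_gt0// ltrBlDr -ltrBlDl.
exists (\row_i q i, r) => [i /=|y yq i]; first by rewrite mxE.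
have := yq i; rewrite /= mxE => yqi.
rewrite (_ : _ - _ = (y ord0 i - ratr (q i)) - (x ord0 i - ratr (q i))); last first.
  by rewrite opprB addrA subrK.
rewrite (le_lt_trans (ler_normB _ _))// (splitr e) ltrD//.
  exact: lt_trans yqi _.
exact: lt_trans (hq i) _.
Qed.

Lemma open_measurable_rV n (U : set 'rV[R]_n) : open U -> measurable U.
Proof.
move=> oU.
have -> : U = \bigcup_(q in [set q | @rat_box n q `<=` U]) rat_box q.
  apply/seteqP; split => [x Ux|x [q /= qU] /qU//].
  have /nbhs_rVP[e e0 eU] : nbhs x U by exact: open_nbhs_nbhs.
  have [q qx qe] := rat_box_nbhs x e0.
  by exists q => //= y /qe; exact: eU.
rewrite bigcup_mkcond; apply: countable_bigcupT_measurable => // q.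
by case: ifP => // _; exact: measurable_rat_box.
Qed.

Lemma closed_measurable_rV n (U : set 'rV[R]_n) : closed U -> measurable U.
Proof.
by move=> /closed_openC/open_measurable_rV/measurableC; rewrite setCK.
Qed.

Lemma open_continuous_measurable_rV n (U : set 'rV[R]_n) (f : 'rV[R]_n -> R) :
  open U -> {in U, continuous f} -> measurable_fun U f.
Proof.
move=> oU cf; apply: (measurability _ (measurable_realfun.RGenOpens.measurableE R)).
move=> _ [_ [a [b ->] <-]]; apply: open_measurable_rV.
rewrite openE => x [Ux fx]; apply: filterI; first exact: open_nbhs_nbhs.
by apply: cf; [rewrite inE|apply: open_nbhs_nbhs; split => //; exact: interval_open].
Qed.
End topo.

(** * Analytic functions are continuous *)

Section analytic.
Context {R : realType}.
#[local] Existing Instance summability.totally_filter.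

Lemma partial_sumE (I : choiceType) (u : I -> R) (B : {fset I}) :
  summability.partial_sum u B = \sum_(i <- B) u i.
Proof. by rewrite /summability.partial_sum big_seq_fsetE. Qed.

Lemma sum_fsubset (I : choiceType) (A B : {fset I}) (F : I -> R) :
  (A `<=` B)%fset -> \sum_(i <- A) F i = \sum_(i <- B | i \in A) F i.
Proof.
move=> /fsubsetP AB; rewrite -[RHS]big_filter; apply: perm_big.
apply: uniq_perm; rewrite ?filter_uniq ?fset_uniq// => i.
by rewrite mem_filter; apply/idP/andP => [iA|[]//]; split=> //; exact: AB.
Qed.

(** Unconditional convergence forces absolute boundedness: beyond a finite set [A] all partial sums
    stay within 1 of [l], so the terms outside [A] have positive and negative parts that differ by
    at most 2 in total variation. Hence the constant 2 added to the sum over [A]. *)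
Lemma partial_sum_cvg_bounded (I : choiceType) (u : I -> R) (l : R) :
  summability.partial_sum u @ summability.totally --> l ->
  exists2 M : R, 0 < M & forall B : {fset I}, \sum_(i <- B) `|u i| <= M.
Proof.
move=> /cvgrPdist_lt /(_ 1 ltr01) [A _ /= hA].
have M0 : 0 <= \sum_(i <- A) `|u i| by exact: sumr_ge0.
exists (\sum_(i <- A) `|u i| + 2); first by rewrite ltr_wpDl.
move=> B.
pose C := (A `|` B)%fset.
apply: (@le_trans _ _ (\sum_(i <- C) `|u i|)).
  rewrite [leRHS](bigID (mem B))/= -sum_fsubset ?fsubsetUr//.
  by rewrite lerDl sumr_ge0.
rewrite (bigID (mem A))/= -sum_fsubset ?fsubsetUl// lerD2l.
(* The sums over Cp and Cn, which both contain A, differ from l by at most 1. *)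
pose Cp := [fset i in C | (i \in A) || (0 <= u i)]%fset.
pose Cn := [fset i in C | (i \in A) || (u i < 0)]%fset.
have ACp : (A `<=` Cp)%fset.
  by apply/fsubsetP => i iA; rewrite !inE/= iA.
have ACn : (A `<=` Cn)%fset.
  by apply/fsubsetP => i iA; rewrite !inE/= iA.
have := hA _ ACp; have := hA _ ACn; rewrite !partial_sumE => hn hp.
have -> : \sum_(i <- C | i \notin A) `|u i| =
    \sum_(i <- Cp) u i - \sum_(i <- Cn) u i.
  rewrite /Cp /Cn -!big_fset_condE/= big_mkcond.
  rewrite [X in X - _]big_mkcond [X in _ - X]big_mkcond -sumrB/=.
  apply: eq_bigr => i _; case: (i \in A) => /=; first by rewrite subrr.
  by case: ltrgt0P => ? /=; rewrite ?subr0 ?sub0r.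
rewrite (_ : _ - _ = (l - \sum_(i <- Cn) u i) - (l - \sum_(i <- Cp) u i)); last first.
  by ring.
by rewrite (le_trans (ler_norm _))// (le_trans (ler_normB _ _))// ltW// (_ : 2 = 1 + 1)// ltrD.
Qed.

(** The terms at the auxiliary point [x0], offset by r / 2 in every coordinate, have bounded
    absolute sums. Shrinking the offset by a factor [t] multiplies each nonconstant term by at most
    [t], and the constant terms cancel, so the variation of every finite partial sum is at most t
    M. *)
Lemma analytic_at_continuous d (f : 'rV[R]_d -> R) a :
  analytic_at f a -> {for a, continuous f}.
Proof.
move=> [c [r [r0 hf]]].
pose x0 : 'rV[R]_d := \row_i (a ord0 i + r / 2).
have [|M M0 hM] := partial_sum_cvg_bounded (hf x0 _).
  by move=> i; rewrite mxE addrAC subrr add0r gtr0_norm ?divr_gt0// ltr_pdivrMr// ltr_pMr// ltr1n.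
apply/(@cvgrPdist_le _ _ _ (nbhs a) _ f (f a)) => e e0; apply/nbhs_rVP.
(* Chosen so that t M is at most [e]; t <= 1 keeps the point inside the polydisc of convergence. *)
pose t := Num.min 1 (e / M).
have t0 : 0 < t by rewrite lt_min ltr01 divr_gt0.
exists (t * (r / 2)); first by rewrite mulr_gt0// divr_gt0.
move=> y ya.
have t1 : t <= 1 by rewrite ge_min lexx.
have tr : t * (r / 2) < r.
  rewrite (le_lt_trans (ler_piMl _ t1))// ?divr_ge0 ?ltW// ltr_pdivrMr// ltr_pMr// ltr1n//.
have hy := hf y (fun i => lt_trans (ya i) tr).
have ha := hf a (fun i => ltac:(by rewrite subrr normr0)).
(* The slack [e'] pays for truncating the series at [y] and at [a] to a common finite set of
   multi-indices. *)
apply/ler_addgt0Pr => e' e'0.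
have e'20 : 0 < e' / 2 by rewrite divr_gt0.
move: hy ha => /cvgrPdist_lt/(_ (e' / 2)) hy /cvgrPdist_lt/(_ (e' / 2)) ha.
have [B [hyB haB]] := filter_ex (filterI (hy e'20) (ha e'20)).
move: hyB haB; rewrite !partial_sumE => hyB haB.
set Fy := \sum_(i <- _) _ in hyB; set Fa := \sum_(i <- _) _ in haB.
have FyFa : `|Fy - Fa| <= e.
  rewrite /Fy /Fa -sumrB (le_trans (ler_norm_sum _ _ _))//.
  apply: (@le_trans _ _ (t * M)); last first.
    by rewrite -ler_pdivlMr// ge_min lexx orbT.
  rewrite (le_trans _ (ler_wpM2l (ltW t0) (hM B)))// mulr_sumr.
  apply: ler_sum => al _; rewrite -mulrBr !normrM mulrCA ler_wpM2l//.
  have -> : \prod_i (x0 ord0 i - a ord0 i) ^+ al i = \prod_i (r / 2) ^+ al i.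
    by apply: eq_bigr => i _; rewrite mxE addrAC subrr add0r.
  have r20 : 0 <= r / 2 by rewrite divr_ge0// ltW.
  rewrite [X in _ <= _ * X]ger0_norm; last by apply: prodr_ge0 => i _; exact: exprn_ge0.
  have [al0|] := pselect (forall i, al i = 0%N).
    rewrite !big1 ?subrr ?normr0 ?mulr_ge0 ?ltW// => i _; rewrite ?al0 ?expr0//.
  move=> /existsNP[i /eqP ali].
  rewrite [X in _ - X](bigD1 i)//= subrr expr0n (negbTE ali) mul0r subr0.
  apply: (@le_trans _ _ (\prod_i (t * (r / 2)) ^+ al i)).
    rewrite normr_prod; apply: ler_prod => j _; rewrite normr_ge0/= normrX.
    by rewrite lerXn2r ?nnegrE ?(mulr_ge0 (ltW t0))//; exact/ltW/ya.
  rewrite (eq_bigr (fun i => t ^+ al i * (r / 2) ^+ al i)); last first.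
    by move=> j _; rewrite exprMn.
  rewrite big_split/= ler_wpM2r//; first by apply: prodr_ge0 => j _; exact: exprn_ge0.
  (* One factor [t] comes from an index with nonzero exponent; the remaining powers of [t] are at
     most 1. *)
  rewrite (bigD1 i)//= -[leRHS]mulr1 ler_pM//.
  - by rewrite exprn_ge0// ltW.
  - by apply: prodr_ge0 => j _; rewrite exprn_ge0// ltW.
  - by rewrite -[leRHS]expr1 ler_wiXn2l ?(ltW t0)// lt0n.
  - by apply: prodr_ile1 => j _; rewrite ?exprn_ge0 ?exprn_ile1 ?(ltW t0).
rewrite (_ : f a - f y = (f a - Fa) - (f y - Fy) - (Fy - Fa)); last first.
  by ring.
rewrite (le_trans (ler_normB _ _))// addrC lerD//.
by rewrite (le_trans (ler_normB _ _))// (splitr e') lerD// ltW.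
Qed.

End analytic.

(** * Bounds, continuity and measurability on a compact domain *)

Section facts.
Context {R : realType}.

Lemma compact_continuous_bounded d (A : set 'rV[R]_d) (f : 'rV[R]_d -> R) :
  compact A -> {within A, continuous f} ->
  exists2 M, 0 < M & forall x, A x -> `|f x| <= M.
Proof.
move=> cA cf; have /compact_bounded := continuous_compact cf cA.
move=> [M [_ hM]]; exists (Num.max 1 (M + 1)); first by rewrite lt_max ltr01.
move=> x Ax; apply: (hM (Num.max 1 (M + 1))); last by exists x.
by rewrite lt_max ltrDl ltr01 orbT.
Qed.

Lemma continuous_coord d (i : 'I_d) : continuous (fun x : 'rV[R]_d => x ord0 i).
Proof.
move=> x; apply/(@cvgrPdist_lt _ _ _ (nbhs x)) => e e0; apply/nbhs_rVP.
by exists e => // y yx; rewrite distrC.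
Qed.

Lemma compact_rV_bounded d (A : set 'rV[R]_d) : compact A ->
  exists2 B, 1 <= B & forall x, A x -> forall i, `|x ord0 i| <= B.
Proof.
move=> cA.
have /choice[M hM] : forall i : 'I_d, exists M, 0 < M /\ forall x, A x -> `|x ord0 i| <= M.
  move=> i; have [M M0 hM] := @compact_continuous_bounded _ A (fun x => x ord0 i) cA
    (continuous_subspaceT (@continuous_coord d i)).
  by exists M.
(* The summand 1 makes the bound at least 1, so that powers of it have nonnegative logarithm. *)
exists (1 + \sum_i M i); first by rewrite lerDl sumr_ge0// => i _; exact: ltW (hM i).1.
move=> x Ax i; rewrite (le_trans ((hM i).2 x Ax))// ler_wpDl// (bigD1 i)//= lerDl.
by apply: sumr_ge0 => j _; exact: ltW (hM j).1.
Qed.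

Lemma real_analytic_on_continuous d (A : set 'rV[R]_d) (f : 'rV[R]_d -> R) :
  real_analytic_on A f -> {within A, continuous f}.
Proof.
move=> [U [F [oU AU aF Ff]]].
have : {within A, continuous F}.
  apply: continuous_in_subspaceT => x; rewrite inE => Ax.
  by apply: analytic_at_continuous; apply: aF; exact: AU.
by apply: subspace_eq_continuous => x; rewrite inE; exact: Ff.
Qed.

Lemma real_analytic_on_measurable d (A : set 'rV[R]_d) (f : 'rV[R]_d -> R) :
  measurable A -> real_analytic_on A f -> measurable_fun A f.
Proof.
move=> mA [U [F [oU AU aF Ff]]].
apply: (@eq_measurable_fun _ _ _ _ _ F); first by move=> x; rewrite inE; exact: Ff.
apply: (measurable_funS (open_measurable_rV oU) AU).
apply: open_continuous_measurable_rV => // x; rewrite inE => Ux.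
by apply: analytic_at_continuous; exact: aF.
Qed.

(** The analytic extension agrees with [f] on [A] only, so unrestricted continuity of [f] is
    available only where [A] is a neighborhood. *)
Lemma real_analytic_on_interior d (A : set 'rV[R]_d) (f : 'rV[R]_d -> R) x :
  real_analytic_on A f -> A° x -> {for x, continuous f}.
Proof.
move=> [U [F [oU AU aF Ff]]] Ax.
have FA : F x = f x by apply: Ff; exact: interior_subset.
have cF : F y @[y --> x] --> f x.
  rewrite -FA; apply: analytic_at_continuous; apply/aF/AU.
  exact: interior_subset.
apply: cvg_trans cF.
by apply: (near_eq_cvg (F := nbhs x)); apply: (@filterS _ (nbhs x) _ A) Ax => y /Ff.
Qed.

(** With [restrict_continuous_exterior], this makes the extension by zero from a closed set
    continuous at every point off the boundary. *)
Lemma restrict_continuous_interior d (A : set 'rV[R]_d) (f : 'rV[R]_d -> R) x :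
  {for x, continuous f} -> A° x -> {for x, continuous (f \_ A)%R}.
Proof.
move=> cf Ax; change ((f \_ A) y @[y --> x] --> (f \_ A) x).
have -> : (f \_ A) x = f x by rewrite /patch mem_set//; exact: interior_subset.
apply: cvg_trans cf; apply: (near_eq_cvg (F := nbhs x)).
apply: (@filterS _ (nbhs x) _ A) Ax => y Ay.
by rewrite /patch mem_set.
Qed.

Lemma restrict_continuous_exterior d (A : set 'rV[R]_d) (f : 'rV[R]_d -> R) x :
  closed A -> ~ A x -> {for x, continuous (f \_ A)%R}.
Proof.
move=> cA Ax; change ((f \_ A) y @[y --> x] --> (f \_ A) x).
have -> : (f \_ A) x = 0 by rewrite /patch memNset.
have h : (fun=> 0 : R) y @[y --> x] --> (0 : R) by exact: cst_continuous.
apply: cvg_trans h.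
apply: (near_eq_cvg (F := nbhs x)).
have : nbhs x (~` A) by apply: open_nbhs_nbhs; split => //; exact: closed_openC.
by apply: (@filterS _ (nbhs x) _ (~` A)) => y Ay; rewrite /patch memNset.
Qed.

End facts.

(** * Volumes of hyperbolic boxes *)

Section vol.
Context {R : realType}.

Lemma ge0_integral_even (f : R -> \bar R) : measurable_fun [set: R] f ->
  (forall x, 0 <= f x)%E -> (forall x, f (- x) = f x) ->
  (\int[lebesgue_measure]_x f x =
   2%:E * \int[lebesgue_measure]_(x in `]0%R, +oo[) f x)%E.
Proof.
move=> mf f0 fN.
have -> : [set: R] = `]-oo, 0%R] `|` `]0%R, +oo[.
  by apply/seteqP; split => x //= _; rewrite !in_itv/= andbT; case: (leP x 0); [left|right].
rewrite ge0_integral_setU//=; last 2 first.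
- exact: measurable_funTS.
- by apply/disj_setPS => x /= []; rewrite !in_itv/= andbT leNgt => /negP.
under eq_integral do rewrite -fN.
rewrite -ge0_integration_by_substitution0// -integral_itv_obnd_cbnd; last first.
  exact: measurable_funTS.
by rewrite mule_natl mule2n.
Qed.

(** The factorials let antidifferentiation preserve the shape of the terms: integrating over one
    more coordinate just shifts the index in the volume formula by one. *)
Lemma is_derive_ln_pow (c x : R) j : 0 < x ->
  is_derive x 1 (fun s : R => (ln s - c) ^+ j.+1 / (j.+1)`!%:R)
    ((ln x - c) ^+ j / j`!%:R / x).
Proof.
move=> x0.
have h1 : is_derive x 1 (fun s : R => ln s - c) x^-1.
  rewrite (_ : (fun _ => _) = (@ln R) - cst c)//.
  apply: is_derive_eq (is_deriveB (is_derive1_ln x0) (is_derive_cst _ _ _)) _.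
  by rewrite subr0.
rewrite (_ : (fun _ => _) = ((j.+1)`!%:R : R)^-1 *: (fun s : R => ln s - c) ^+ j.+1); last first.
  by apply/funext => s; rewrite !fctE -[RHS]mulrC.
apply: is_derive_eq.
rewrite /= /GRing.scale/= factS natrM.
have j1 : (j.+1%:R : R) != 0 by rewrite pnatr_eq0.
have j2 : (j`!%:R : R) != 0 by rewrite pnatr_eq0 -lt0n fact_gt0.
have := j2; have := j1; rewrite -!natr1 => ? ?; field; apply/and3P; split=> //.
by rewrite gt_eqF.
Qed.

Lemma ln_pow_within_continuous (a b : R) j : 0 < a ->
  {within `[a, b], continuous (fun s : R => (ln s - ln a) ^+ j / j`!%:R / s)}.
Proof.
move=> a0; pose f (s : R) : R := (ln s - ln a) ^+ j / j`!%:R / s.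
have cf (x : R) : 0 < x -> {for x, continuous f}.
  move=> x0; rewrite /f; apply: cvgM; last by apply: cvgV; [rewrite gt_eqF|exact: cvg_id].
  apply: cvgM; last exact: cvg_cst.
  apply: (@cvg_comp _ _ _ (fun s => ln s - ln a) (fun y => y ^+ j)); last exact: exprn_continuous.
  by apply: cvgB; [exact: continuous_ln|exact: cvg_cst].
apply: continuous_in_subspaceT => x; rewrite inE/= in_itv/= => /andP[ax _].
by apply: cf; exact: lt_le_trans ax.
Qed.

Lemma measurable_ln_pow (a b : R) j : 0 < a ->
  measurable_fun `]a, b] (fun s : R => ((ln s - ln a) ^+ j / j`!%:R / s)%:E).
Proof.
move=> a0; apply/measurable_EFinP; apply: subspace_continuous_measurable_fun => //.
have wf := @ln_pow_within_continuous a b j a0.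
apply: continuous_subspaceW wf; exact: subset_itv_oc_cc.
Qed.

Lemma integral_ln_pow (a b : R) j : 0 < a -> a < b ->
  (\int[lebesgue_measure]_(s in `]a, b]) ((ln s - ln a) ^+ j / j`!%:R / s)%:E =
   ((ln b - ln a) ^+ j.+1 / (j.+1)`!%:R)%:E)%E.
Proof.
move=> a0 ab.
pose F (s : R) := (ln s - ln a) ^+ j.+1 / (j.+1)`!%:R.
pose f (s : R) := (ln s - ln a) ^+ j / j`!%:R / s.
have dF (x : R) : 0 < x -> is_derive x 1 F (f x) by exact: is_derive_ln_pow.
have cF (x : R) : 0 < x -> {for x, continuous F}.
  move=> x0; apply: differentiable_continuous; apply/derivable1_diffP.
  by have [] := dF _ x0.
have wf := @ln_pow_within_continuous a b j a0.
rewrite integral_itv_obnd_cbnd; last exact: measurable_ln_pow.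
rewrite (@continuous_FTC2 _ f F)//.
- by rewrite /F subrr expr0n/= mul0r oppr0 adde0.
- split.
  + by move=> x; rewrite in_itv/= => /andP[ax _]; have [] := dF x (lt_trans a0 ax).
  + by apply: cvg_at_right_filter; apply: cF.
  + by apply: cvg_at_left_filter; apply: cF; exact: lt_trans ab.
- move=> x; rewrite in_itv/= => /andP[ax _]; rewrite derive1E.
  by have [_] := dF x (lt_trans a0 ax).
Qed.

End vol.

Section volume.
Context {R : realType}.
Local Notation mu := lebesgue_measure.

Definition box_hyp m (B t : R) : set 'rV[R]_m :=
  [set x | (forall i, `|x ord0 i| <= B) /\ \prod_i `|x ord0 i| <= t].

(** In the second case the bound on the product follows from the bounds on the coordinates, and the
    set is the whole cube. *)
Definition box_hyp_vol m (B t : R) : R :=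
  if t < B ^+ m then 2 ^+ m * t * \sum_(k < m) ln (B ^+ m / t) ^+ k / k`!%:R
  else (2 * B) ^+ m.

Lemma measurable_normr_coord m (i : 'I_m) :
  measurable_fun [set: 'rV[R]_m] (fun x => `|x ord0 i|).
Proof.
apply: (measurableT_comp (@normr_measurable R setT)).
exact: (@measurable_coord _ (measurableTypeR R)).
Qed.

Lemma measurable_prod_normr m :
  measurable_fun [set: 'rV[R]_m] (fun x => \prod_i `|x ord0 i|).
Proof. by apply: measurable_prod => i _; exact: measurable_normr_coord. Qed.

Lemma measurable_cube m (B : R) :
  measurable [set x : 'rV[R]_m | forall i, `|x ord0 i| <= B].
Proof.
have -> : [set x : 'rV[R]_m | forall i, `|x ord0 i| <= B] =
    \bigcap_(i in [set` 'I_m]) [set x : 'rV[R]_m | `|x ord0 i| <= B].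
  by apply/seteqP; split => x h i; [move=> _; exact: h|exact: (h i erefl)].
apply: fin_bigcap_measurable => // i _.
rewrite -[X in measurable X]setTI.
exact: (@measurable_fun_le _ _ R setT _ _ measurableT (measurable_normr_coord i)
  (measurable_cst B)).
Qed.

Lemma measurable_box_hyp m B t : measurable (@box_hyp m B t).
Proof.
apply: measurableI; first exact: measurable_cube.
rewrite -[X in measurable X]setTI.
exact: (@measurable_fun_le _ _ R setT _ _ measurableT (@measurable_prod_normr m)
  (measurable_cst t)).
Qed.

Lemma cons_rV_forall n (P : R -> Prop) s (v : 'rV[R]_n) :
  (forall i, P (cons_rV (s, v) ord0 i)) <-> P s /\ forall i, P (v ord0 i).
Proof.
split=> [h|[h1 h2] i].
  split; first by rewrite -(cons_rV0 s v).
  by move=> i; rewrite -(cons_rVS s v).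
have [k ->|->] := unliftP (ord0 : 'I_n.+1) i; first by rewrite cons_rVS.
by rewrite cons_rV0.
Qed.

Lemma prod_cons_rV n (F : R -> R) s (v : 'rV[R]_n) :
  \prod_i F (cons_rV (s, v) ord0 i) = F s * \prod_i F (v ord0 i).
Proof.
rewrite big_ord_recl cons_rV0; congr (_ * _).
by apply: eq_bigr => i _; rewrite cons_rVS.
Qed.

Lemma box_hyp_large m (B t : R) (x : 'rV[R]_m) : B ^+ m <= t ->
  (forall i, `|x ord0 i| <= B) -> \prod_i `|x ord0 i| <= t.
Proof.
move=> Bt xB; apply: le_trans Bt.
rewrite -[X in B ^+ X](card_ord m) -prodr_const; apply: ler_prod => i _.
by rewrite normr_ge0/= xB.
Qed.

(** Induction on the dimension: the slice at first coordinate s is the box with product bound t /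
    |s|. It is a full cube for |s| <= a = t / B^m. For a < |s| <= B its logarithm is ln |s| - ln a,
    and the induction hypothesis can be integrated term by term. *)
Lemma lebesgue_box_hyp m (B t : R) : 0 < B -> 0 < t ->
  lebesgue_rV m (@box_hyp m B t) = (box_hyp_vol m B t)%:E.
Proof.
move=> B0; elim: m t => [|m IH] t t0.
  rewrite /box_hyp_vol expr0 /= diracE; case: ltP => t1.
    rewrite memNset; first by rewrite big_ord0 mulr0.
    by rewrite /box_hyp/= big_ord0 leNgt t1 => -[].
  by rewrite mem_set// /box_hyp/= big_ord0; split=> // -[].
(* The cube is the hyperbolic box with t = B^m, so its volume is an instance of the induction
   hypothesis. *)
have cubeE : lebesgue_rV m [set x : 'rV[R]_m | forall i, `|x ord0 i| <= B] =
    ((2 * B) ^+ m)%:E.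
  have -> : [set x : 'rV[R]_m | forall i, `|x ord0 i| <= B] = box_hyp B (B ^+ m).
    apply/seteqP; split => x /= => [xB|[]//]; split=> //.
    exact: box_hyp_large xB.
  by rewrite IH ?exprn_gt0// /box_hyp_vol ltxx.
rewrite lebesgue_rV_consE.
set H := fun s : R => lebesgue_rV m [set v | box_hyp B t (cons_rV (s, v))].
have HE s : [set v : 'rV[R]_m | box_hyp B t (cons_rV (s, v))] =
    [set v : 'rV[R]_m | `|s| <= B /\ (forall i, `|v ord0 i| <= B) /\
       `|s| * \prod_i `|v ord0 i| <= t].
  apply/seteqP; split => v /=; rewrite /box_hyp/= (prod_cons_rV Num.norm).
    by move=> [/(@cons_rV_forall _ (fun x => `|x| <= B))[]].
  by move=> [sB [vB st]]; split => //; apply/(@cons_rV_forall _ (fun x => `|x| <= B)).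
have mH : measurable_fun [set: R] H.
  exact: measurable_fun_cons_slice (measurable_box_hyp _ _).
rewrite (ge0_integral_even mH)//; last first.
  by move=> s; rewrite /H !HE normrN.
pose a := t / B ^+ m.
have a0 : 0 < a by rewrite divr_gt0// exprn_gt0.
have Hsmall s : 0 < s -> s <= B -> s <= a -> H s = ((2 * B) ^+ m)%:E.
  move=> s0 sB sa; rewrite /H HE -cubeE; congr (lebesgue_rV m _).
  rewrite gtr0_norm//.
  apply/seteqP; split => v /= => [[_ []]//|vB]; split=> //; split=> //.
  rewrite -ler_pdivlMl//; apply: box_hyp_large vB.
  by rewrite ler_pdivlMl// -ler_pdivlMr// exprn_gt0.
have Hlarge s : s <= B -> a < s -> H s = (2 ^+ m * t *
    \sum_(k < m) (ln s - ln a) ^+ k / k`!%:R / s)%:E.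
  move=> sB sa; have s0 := lt_trans a0 sa.
  rewrite /H HE gtr0_norm//.
  have -> : [set v : 'rV[R]_m | s <= B /\ (forall i, `|v ord0 i| <= B) /\
       s * \prod_i `|v ord0 i| <= t] = box_hyp B (t / s).
    apply/seteqP; split => v /= => [[_ [vB vt]]|[vB vt]]; split=> //.
      by rewrite ler_pdivlMr// mulrC.
    by split=> //; rewrite mulrC -ler_pdivlMr.
  rewrite IH ?divr_gt0// /box_hyp_vol ifT; last first.
    by rewrite ltr_pdivrMr// mulrC -ltr_pdivrMr// exprn_gt0.
  congr EFin; rewrite -!mulrA; congr (_ * (_ * _)); rewrite mulr_sumr.
  apply: eq_bigr => k _; rewrite mulrC; congr (_ ^+ _ / _ / _).
  rewrite -ln_div ?posrE//; congr ln; rewrite /a !invfM !invrK; ring.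
have Hbig s : B < s -> H s = 0%E.
  move=> Bs; rewrite /H HE (_ : [set _ | _] = set0) ?measure0//.
  apply/seteqP; split=> // v /= [+ _]; rewrite leNgt => /negP; apply.
  by rewrite (lt_le_trans Bs)// ler_norm.
have H0 s : (0 <= H s)%E by exact: measure_ge0.
have -> : `]0, +oo[%classic = `]0, B] `|` `]B, +oo[ :> set R.
  by rewrite -itv_bndbnd_setU ?bnd_simp// ltW.
rewrite ge0_integral_setU//=; last 2 first.
- exact: measurable_funTS.
- by apply/disj_setPS => x /= []; rewrite !in_itv/= andbT => /andP[_]; rewrite leNgt => /negP.
rewrite [X in (_ * (_ + X))%E](@integral0_eq); last first.
  by move=> x /=; rewrite in_itv/= andbT => /Hbig.
rewrite adde0 /box_hyp_vol.
(* If t >= B^(m+1) then a >= B, and every slice with |s| <= B is a full cube. *)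
case: ltP => tB; last first.
  rewrite (eq_integral (cst ((2 * B) ^+ m)%:E)); last first.
    move=> s; rewrite inE/= in_itv/= => /andP[s0 sB]; rewrite Hsmall// /a.
    by rewrite ler_pdivlMr ?exprn_gt0// (le_trans _ tB)// exprS ler_wpM2r// exprn_ge0// ltW.
  rewrite integral_cst//= lebesgue_measure_itv/= lte_fin B0 oppr0 adde0 -!EFinM.
  by congr EFin; rewrite exprS; ring.
have aB : a < B by rewrite /a ltr_pdivrMr ?exprn_gt0// -exprS.
have -> : `]0, B]%classic = `]0, a] `|` `]a, B] :> set R.
  by rewrite -itv_bndbnd_setU ?bnd_simp// ltW.
rewrite ge0_integral_setU//=; last 2 first.
- exact: measurable_funTS.
- by apply/disj_setPS => x /= []; rewrite !in_itv/= => /andP[_ xa] /andP[]; rewrite ltNge xa.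
rewrite (eq_integral (cst ((2 * B) ^+ m)%:E)); last first.
  move=> s; rewrite inE/= in_itv/= => /andP[s0 sa]; rewrite Hsmall//.
  by rewrite (le_trans sa)// ltW.
rewrite integral_cst//= lebesgue_measure_itv/= lte_fin a0 oppr0 adde0.
under eq_integral => s.
  rewrite inE/= in_itv/= => /andP[sa sB]; rewrite Hlarge// EFinM -sumEFin.
  over.
have mlog k := @measurable_ln_pow R a B k a0.
have log0 (k : nat) (s : R) : `]a, B]%classic s -> (0 <= ((ln s - ln a) ^+ k / k`!%:R / s)%:E)%E.
  rewrite /= in_itv/= => /andP[sa sB]; rewrite lee_fin.
  have s0 := lt_trans a0 sa.
  by rewrite !divr_ge0 ?exprn_ge0 ?subr_ge0 ?ler_ln ?posrE ?ltW.
rewrite ge0_integralZl//=; last 3 first.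
- by apply: emeasurable_sum => k; exact: (mlog k).
- by move=> s sI; apply: sume_ge0 => k _; exact: log0.
- by rewrite lee_fin mulr_ge0 ?exprn_ge0// ltW.
rewrite ge0_integral_sum//; last by move=> k s sI; exact: log0.
rewrite [in LHS](eq_bigr (fun k : 'I_m =>
    ((ln B - ln a) ^+ k.+1 / (k.+1)`!%:R)%:E)); last first.
  by move=> k _; exact: integral_ln_pow.
  2: by move=> k; exact: (mlog k).
rewrite sumEFin -!EFinM; congr EFin.
(* The term k = 0 of the new sum is the contribution of ]0, a]; the others come from ]a, B] with the
   index raised by one. *)
rewrite big_ord_recl/= expr0 fact0 divr1.
have -> : ln (B ^+ m.+1 / t) = ln B - ln a.
  rewrite -ln_div ?posrE//; congr ln; rewrite /a invfM invrK exprS; ring.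
have -> : (2 * B) ^+ m * a = 2 ^+ m * t.
  by rewrite exprMn /a mulrAC mulrA divfK ?gt_eqF ?exprn_gt0// mulrC mulrA mulrC.
rewrite exprS; ring.
Qed.
End volume.

(** * Bounds and asymptotics for the volumes of hyperbolic boxes *)

Section asympt.
Context {R : realType}.
Local Notation mu := lebesgue_measure.

Lemma cvg_big_sum (T I : Type) (G : set_system T) (FG : Filter G) (r : seq I)
    (f : I -> T -> R) (l : I -> R) :
  (forall i, f i x @[x --> G] --> l i) ->
  \sum_(i <- r) f i x @[x --> G] --> \sum_(i <- r) l i.
Proof.
move=> fl; elim: r => [|i r IH].
  by under eq_fun do rewrite big_nil; rewrite big_nil; exact: cvg_cst.
under eq_fun do rewrite big_cons; rewrite big_cons; exact: cvgD.
Qed.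

(** As 1 <= D, each of the [m] terms is at most D^(m-1); in the cube case B^m <= t gives the bound
    directly. Apart from [D] the bound is linear in [t], which is what produces an integrable
    dominating function. *)
Lemma box_hyp_vol_le m (B t D : R) : (0 < m)%N -> 0 < B -> 0 < t -> 1 <= D ->
  ln (B ^+ m / t) <= D ->
  box_hyp_vol m B t <= 2 ^+ m * t * (m%:R * D ^+ m.-1).
Proof.
move=> m0 B0 t0 D1 LD; rewrite /box_hyp_vol.
have D0 : 0 <= D by rewrite (le_trans ler01).
case: ltP => tB.
  rewrite ler_wpM2l//; first by rewrite mulr_ge0 ?exprn_ge0 ?(ltW t0).
  have L0 : 0 <= ln (B ^+ m / t) by rewrite ln_ge0// ler_pdivlMr// mul1r ltW.
  rewrite mulr_natl -[X in _ *+ X](card_ord m) -sumr_const; apply: ler_sum => k _.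
  rewrite ler_pdivrMr ?ltr0n ?fact_gt0//.
  apply: (@le_trans _ _ (D ^+ k)); first by rewrite lerXn2r ?nnegrE.
  rewrite -[leLHS]mulr1 ler_pM ?exprn_ge0 ?ler1n ?fact_gt0//.
  by rewrite ler_weXn2l// -ltnS prednK.
rewrite exprMn -mulrA ler_wpM2l ?exprn_ge0//.
rewrite (le_trans tB)// -[leLHS]mulr1 ler_wpM2l ?(ltW t0)//.
by rewrite -[leLHS]mulr1 ler_pM ?ler1n// exprn_ege1.
Qed.

Lemma cvg_oppln_inv : (- ln s)^-1 @[s --> (0 : R)^'+] --> (0 : R).
Proof.
apply/cvgrPdist_le => e e0.
near=> s.
have s0 : 0 < s by [].
have lns : ln s <= - e^-1.
  rewrite -[leRHS]expRK ler_ln ?posrE ?expR_gt0//.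
  near: s; apply: nbhs_right_le; exact: expR_gt0.
have ln0 : 0 < - ln s by rewrite (lt_le_trans _ (_ : e^-1 <= _)) ?invr_gt0// lerNr.
rewrite sub0r normrN gtr0_norm ?invr_gt0// -[leRHS]invrK lef_pV2 ?posrE ?invr_gt0//.
by rewrite lerNr.
Unshelve. all: end_near. Qed.

(** In the variable z = 1 / (-ln s) the quotient is a constant times the polynomial [P]: the
    logarithm equals (-ln s) (b z + 1), so the k-th term carries z^(m-k) and only k = m survives at
    z = 0. The side [B] enters through [b] alone, hence not in the limit. *)
Lemma box_hyp_vol_cvg m (B c : R) : 0 < B -> 0 < c ->
  box_hyp_vol m.+1 B (c * s) / (s * (- ln s) ^+ m) @[s --> 0^'+] -->
  2 ^+ m.+1 / m`!%:R * c.
Proof.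
move=> B0 c0.
pose b := ln (B ^+ m.+1 / c).
pose P z := \sum_(k < m.+1) ((b * z + 1) ^+ k * z ^+ (m - k) / k`!%:R).
have P0 : P 0 = (m`!%:R)^-1.
  rewrite /P big_ord_recr/= subnn expr0 mulr0 add0r expr1n mulr1 mul1r big1 ?add0r// => k _.
  by rewrite expr0n subn_eq0 leqNgt ltn_ord mulr0 mul0r.
have cP : P z @[z --> (0 : R)] --> P 0.
  apply: cvg_big_sum => k; apply: cvgM; last exact: cvg_cst.
  apply: cvgM; last exact: exprn_continuous.
  apply: (@cvg_comp _ _ _ (fun z => b * z + 1) (fun y => y ^+ k)); last exact: exprn_continuous.
  by apply: cvgD; [apply: cvgM; [exact: cvg_cst|exact: cvg_id]|exact: cvg_cst].
have -> : 2 ^+ m.+1 / m`!%:R * c = 2 ^+ m.+1 * c * P 0 by rewrite P0; ring.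
have h : 2 ^+ m.+1 * c * P ((- ln s)^-1) @[s --> 0^'+] --> 2 ^+ m.+1 * c * P 0.
  apply: cvgM; first exact: cvg_cst.
  exact: (cvg_comp _ _ cvg_oppln_inv).
apply: cvg_trans h; apply: near_eq_cvg; near=> s.
have s0 : 0 < s by [].
have T0 : 0 < - ln s.
  rewrite oppr_gt0 ln_lt0// s0/=; near: s; exact: nbhs_right_lt.
have cs : c * s < B ^+ m.+1.
  rewrite mulrC -ltr_pdivlMr//; near: s; apply: nbhs_right_lt.
  by rewrite divr_gt0 ?exprn_gt0.
rewrite /box_hyp_vol cs.
have -> : ln (B ^+ m.+1 / (c * s)) = b - ln s.
  by rewrite /b -ln_div ?posrE ?divr_gt0 ?exprn_gt0// -mulrA -invfM.
set T := - ln s in T0 *; have Tn0 : T != 0 by rewrite gt_eqF.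
rewrite /P; have -> : forall X, 2 ^+ m.+1 * (c * s) * X / (s * T ^+ m) =
    2 ^+ m.+1 * c * (X / T ^+ m).
  by move=> X; field; rewrite ?expf_neq0 ?gt_eqF.
congr (_ * _); rewrite mulr_suml; apply: eq_bigr => k _.
have -> : T ^+ m = T ^+ k * T ^+ (m - k) by rewrite -exprD subnKC// -ltnS.
have -> : b + T = T * (b / T + 1) by field.
rewrite exprMn exprVn; field.
by rewrite !expf_neq0// pnatr_eq0 -lt0n fact_gt0.
Unshelve. all: end_near. Qed.

End asympt.

(** * The integral over one fiber, for densities continuous at the origin *)

Section local.
Context {R : realType}.
Variables (m : nat) (psi theta : 'rV[R]_m.+1 -> R) (M c0 B : R).
Hypotheses (mpsi : measurable_fun [set: 'rV[R]_m.+1] psi)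
  (mtheta : measurable_fun [set: 'rV[R]_m.+1] theta)
  (psi0 : forall x, 0 <= psi x) (psiM : forall x, psi x <= M)
  (theta0 : forall x, 0 <= theta x) (thetac : forall x, theta x <= c0)
  (c0_gt0 : 0 < c0) (B_gt0 : 0 < B)
  (cpsi : {for 0, continuous psi}) (ctheta : {for 0, continuous theta}).
Local Notation K := (2 ^+ m.+1 / m`!%:R : R).

(** The sublevel set in one fiber, with s = lambda^ell. The varying bound [theta] is what separates
    it from a hyperbolic box, and it is compared with boxes for the constant bounds theta(0) + d and
    theta(0) - d near 0. *)
Definition hyp_set (s : R) : set 'rV[R]_m.+1 :=
  [set x : 'rV[R]_m.+1 | (forall i, `|x ord0 i| <= B) /\ \prod_i `|x ord0 i| <= s * theta x].

Let hyp_integral s := (\int[lebesgue_rV m.+1]_(x in hyp_set s) (psi x)%:E)%E.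

Lemma measurable_hyp_set s : measurable (hyp_set s).
Proof.
apply: measurableI; first exact: measurable_cube.
rewrite -[X in measurable X]setTI.
apply: (@measurable_fun_le _ _ R setT _ _ measurableT (@measurable_prod_normr R m.+1)).
by apply: measurable_funM => //.
Qed.

Lemma bound_ge0 : 0 <= M. Proof. exact: le_trans (psi0 0) (psiM 0). Qed.

Lemma near_cube d : 0 < d -> exists e, [/\ 0 < e, e <= B &
  forall x : 'rV[R]_m.+1, (forall i, `|x ord0 i| <= e) ->
    `|psi x - psi 0| <= d /\ `|theta x - theta 0| <= d].
Proof.
move=> d0.
have H : \forall x \near nbhs (0 : 'rV[R]_m.+1),
    `|psi x - psi 0| <= d /\ `|theta x - theta 0| <= d.
  apply: filterI.
    have := cpsi => /(@cvgrPdist_le _ _ _ (nbhs _)) /(_ _ d0).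
    by apply: filterS => x; rewrite distrC.
  have := ctheta => /(@cvgrPdist_le _ _ _ (nbhs _)) /(_ _ d0).
  by apply: filterS => x; rewrite distrC.
move: H => /nbhs_rVP[r r0 hr].
exists (Num.min (r / 2) B); split.
- by rewrite lt_min divr_gt0.
- by rewrite ge_min lexx orbT.
- move=> x xr; apply: hr => i; rewrite mxE subr0 (le_lt_trans (xr i))//.
  by rewrite gt_min ltr_pdivrMr// ltr_pMr// ltr1n.
Qed.

Lemma le_box_hyp (e t : R) : e <= B -> @box_hyp R m.+1 e t `<=` box_hyp B t.
Proof. by move=> eB x [xe xt]; split => // i; exact: le_trans eB. Qed.

Lemma measurable_scaled_indic (E : set 'rV[R]_m.+1) (k : R) : measurable E ->
  measurable_fun [set: 'rV[R]_m.+1] (fun x => (k * \1_E x)%:E).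
Proof.
by move=> mE; apply/measurable_EFinP; apply: measurable_funM => //; exact: measurable_indic.
Qed.

Lemma integral_scaled_indic (E : set 'rV[R]_m.+1) (k : R) : measurable E -> 0 <= k ->
  (k%:E * lebesgue_rV m.+1 E = \int[lebesgue_rV m.+1]_x (k * \1_E x)%:E)%E.
Proof.
move=> mE k0; under eq_integral do rewrite EFinM.
rewrite ge0_integralZl//; first by rewrite integral_indic// setIT.
by apply/measurable_EFinP; exact: measurable_indic.
Qed.

(* Near 0 the integrand is controlled by continuity; the remaining part of the
   domain lies in the difference of two hyperbolic boxes whose volumes have the
   same leading term. *)
Lemma hyp_integral_le d e s : 0 < d -> 0 < e -> e <= B -> 0 < s ->
  (forall x : 'rV[R]_m.+1, (forall i, `|x ord0 i| <= e) ->
    `|psi x - psi 0| <= d /\ `|theta x - theta 0| <= d) ->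
  (hyp_integral s <= ((psi 0 + d) * box_hyp_vol m.+1 e ((theta 0 + d) * s) +
     M * (box_hyp_vol m.+1 B (c0 * s) - box_hyp_vol m.+1 e (c0 * s)))%:E)%E.
Proof.
move=> d0 e0 eB s0 he.
have td0 : 0 < (theta 0 + d) * s by rewrite mulr_gt0// ltr_wpDl.
have cs0 : 0 < c0 * s by rewrite mulr_gt0.
have mE1 := @measurable_box_hyp R m.+1 e ((theta 0 + d) * s).
have mE2 : measurable (@box_hyp R m.+1 B (c0 * s) `\` box_hyp e (c0 * s)).
  by apply: measurableD; exact: measurable_box_hyp.
rewrite EFinD !EFinM.
have -> : (box_hyp_vol m.+1 B (c0 * s) - box_hyp_vol m.+1 e (c0 * s))%:E =
    lebesgue_rV m.+1 (@box_hyp R m.+1 B (c0 * s) `\` box_hyp e (c0 * s)).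
  have mb t r : measurable (@box_hyp R m.+1 t r) by exact: measurable_box_hyp.
  have fin : (lebesgue_rV m.+1 (@box_hyp R m.+1 B (c0 * s)) < +oo)%E.
    by rewrite lebesgue_box_hyp// ltry.
  rewrite EFinB -!lebesgue_box_hyp//; apply/esym.
  by rewrite -{2}(setIidr (le_box_hyp eB)); exact: measureD.
rewrite -lebesgue_box_hyp//.
rewrite (integral_scaled_indic mE1) ?(integral_scaled_indic mE2) ?bound_ge0 ?addr_ge0 ?(ltW d0)//.
have i0 (E : set 'rV[R]_m.+1) k x : 0 <= k -> (0 <= (k * \1_E x)%:E)%E.
  by move=> k0; rewrite lee_fin mulr_ge0// indicE.
have pd0 : 0 <= psi 0 + d by rewrite addr_ge0// ltW.
rewrite -ge0_integralD//; last 4 first.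
- by move=> x _; exact: i0.
- exact: measurable_scaled_indic.
- by move=> x _; apply: i0; exact: bound_ge0.
- exact: measurable_scaled_indic.
rewrite /hyp_integral [leLHS]integral_mkcond; apply: ge0_le_integral => //.
- by move=> x _; rewrite /patch; case: ifP => //; rewrite lee_fin.
- apply/(measurable_restrictT _ (measurable_hyp_set s)).
  by apply: measurable_funTS; exact/measurable_EFinP.
- by apply: emeasurable_funD; exact: measurable_scaled_indic.
move=> x _; rewrite /patch; case: ifPn => [|_]; last first.
  by rewrite adde_ge0// i0// bound_ge0.
rewrite inE => -[xB xt].
rewrite -EFinD lee_fin !indicE.
have [xe|xe] := pselect (forall i, `|x ord0 i| <= e).
  have [+ +] := he _ xe; rewrite !ler_distl => /andP[_ px] /andP[_ tx].
  rewrite mem_set ?mulr1; last first.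
    by split => //; rewrite (le_trans xt)// mulrC ler_wpM2r// ltW.
  by rewrite (le_trans px)// lerDl mulr_ge0 ?bound_ge0.
rewrite [x \in _ `\` _]mem_set ?mulr1; last first.
  split; last by move=> -[].
  by split=> //; rewrite (le_trans xt)// mulrC ler_wpM2r// ltW.
by rewrite (le_trans (psiM x))// lerDr mulr_ge0// addr_ge0// ltW.
Qed.

(** Only the part of the domain in the small cube is kept. The assumptions that [d] lies below
    psi(0) and theta(0) make the lower bounds positive; when one of these values vanishes, the limit
    is 0 and nonnegativity suffices. *)
Lemma hyp_integral_ge d e s : 0 < d -> 0 < e -> e <= B -> 0 < s -> d < psi 0 -> d < theta 0 ->
  (forall x : 'rV[R]_m.+1, (forall i, `|x ord0 i| <= e) ->
    `|psi x - psi 0| <= d /\ `|theta x - theta 0| <= d) ->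
  (((psi 0 - d) * box_hyp_vol m.+1 e ((theta 0 - d) * s))%:E <= hyp_integral s)%E.
Proof.
move=> d0 e0 eB s0 pd td he.
have td0 : 0 < (theta 0 - d) * s by rewrite mulr_gt0// subr_gt0.
have mE1 := @measurable_box_hyp R m.+1 e ((theta 0 - d) * s).
rewrite EFinM -lebesgue_box_hyp//.
have pd0 : 0 <= psi 0 - d by rewrite subr_ge0 ltW.
rewrite (integral_scaled_indic mE1)//.
rewrite /hyp_integral [leRHS]integral_mkcond; apply: ge0_le_integral => //.
- by move=> x _; rewrite lee_fin mulr_ge0// indicE.
- exact: measurable_scaled_indic.
- apply/(measurable_restrictT _ (measurable_hyp_set s)).
  by apply: measurable_funTS; exact/measurable_EFinP.
move=> x _; rewrite /patch indicE.
have [xE|xE] := boolP (x \in box_hyp _ _); last first.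
  by rewrite mulr0; case: ifP => //; rewrite lee_fin.
move: xE; rewrite inE => -[xe xt].
have [+ +] := he _ xe; rewrite !ler_distl => /andP[px _] /andP[tx _].
rewrite mem_set ?lee_fin ?mulr1//.
split; first by move=> i; exact: le_trans eB.
by rewrite (le_trans xt)// mulrC ler_wpM2l// ltW.
Qed.

(** The order of choices is [d] from [eps], then the side [e] of the small cube from [d], then [s].
    Both bounds tend to constants within eps / 2 of the limit, and the other half of [eps] absorbs
    the convergence. *)
Lemma hyp_integral_cvg :
  fine (hyp_integral s) / (s * (- ln s) ^+ m) @[s --> 0^'+] --> K * (theta 0 * psi 0).
Proof.
have Kge0 : 0 <= K by rewrite divr_ge0 ?exprn_ge0.
apply/cvgrPdist_le => eps eps0.
have [d d0 [hd1 hd2]] : exists2 d : R, 0 < d &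
    K * ((theta 0 + d) * (psi 0 + d)) < K * (theta 0 * psi 0) + eps / 2 /\
    (0 < psi 0 -> 0 < theta 0 -> [/\ d < psi 0, d < theta 0 &
      K * (theta 0 * psi 0) - eps / 2 < K * ((theta 0 - d) * (psi 0 - d))]).
  have c1 : K * ((theta 0 + d) * (psi 0 + d)) @[d --> (0:R)^'+] -->
      K * ((theta 0 + 0) * (psi 0 + 0)).
    apply: cvg_at_right_filter.
    apply: cvgM; first exact: cvg_cst.
    by apply: cvgM; apply: cvgD; [exact: cvg_cst|exact: cvg_id|exact: cvg_cst|exact: cvg_id].
  have c2 : K * ((theta 0 - d) * (psi 0 - d)) @[d --> (0:R)^'+] -->
      K * ((theta 0 - 0) * (psi 0 - 0)).
    apply: cvg_at_right_filter.
    apply: cvgM; first exact: cvg_cst.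
    by apply: cvgM; apply: cvgB; [exact: cvg_cst|exact: cvg_id|exact: cvg_cst|exact: cvg_id].
  rewrite !addr0 in c1; rewrite !subr0 in c2.
  have n1 : \forall d \near (0 : R)^'+,
      K * ((theta 0 + d) * (psi 0 + d)) < K * (theta 0 * psi 0) + eps / 2.
    by apply: (cvgr_lt _ c1); rewrite ltrDl divr_gt0.
  have [/andP[p0 t0]|h] := boolP ((0 < psi 0) && (0 < theta 0)); last first.
    near (0 : R)^'+ => d; exists d => //; split; first by near: d.
    by move=> p0 t0; move: h; rewrite p0 t0.
  near (0 : R)^'+ => d; exists d => //; split; first by near: d.
  move=> _ _; split.
  - by near: d; exact: nbhs_right_lt.
  - by near: d; exact: nbhs_right_lt.
  - by near: d; apply: (cvgr_gt _ c2); rewrite ltrBlDr ltrDl divr_gt0.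
have [e [e0 eB he]] := near_cube d0.
have td0 : 0 < theta 0 + d by rewrite ltr_wpDl.
have cU : (psi 0 + d) * (box_hyp_vol m.+1 e ((theta 0 + d) * s) / (s * (- ln s) ^+ m)) +
     M * (box_hyp_vol m.+1 B (c0 * s) / (s * (- ln s) ^+ m)
        - box_hyp_vol m.+1 e (c0 * s) / (s * (- ln s) ^+ m))
   @[s --> 0^'+] --> (psi 0 + d) * (K * (theta 0 + d)) + M * (K * c0 - K * c0).
  apply: cvgD; (apply: cvgM; first exact: cvg_cst); first exact: box_hyp_vol_cvg.
  by apply: cvgB; exact: box_hyp_vol_cvg.
(* Boxes of sides [B] and [e] with the same product bound have the same leading term, so the region
   away from 0 drops out despite the crude bound [M]. *)
rewrite subrr mulr0 addr0 in cU.
have Npos : \forall s \near (0 : R)^'+, 0 < s * (- ln s) ^+ m.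
  near=> s; have s0 : 0 < s by [].
  rewrite mulr_gt0 ?exprn_gt0// oppr_gt0 ln_lt0// s0/=.
  by near: s; exact: nbhs_right_lt.
have Jge0 s : (0 <= hyp_integral s)%E by apply: integral_ge0 => x _; rewrite lee_fin.
(* Finiteness is recorded as well, because [fine] sends +oo to 0 and would make the estimate
   meaningless. *)
have upper : \forall s \near (0 : R)^'+,
    hyp_integral s \is a fin_num /\
    fine (hyp_integral s) / (s * (- ln s) ^+ m) <= K * (theta 0 * psi 0) + eps.
  near=> s; have s0 : 0 < s by [].
  have N0 : 0 < s * (- ln s) ^+ m by near: s.
  have Js := hyp_integral_le d0 e0 eB s0 he.
  have Jfin : hyp_integral s \is a fin_num by rewrite ge0_fin_numE// (le_lt_trans Js) ?ltry.
  split=> //; move: Js; rewrite -(fineK Jfin) lee_fin => Js.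
  rewrite ler_pdivrMr// (le_trans Js)// -ler_pdivrMr//.
  apply: (@le_trans _ _ ((psi 0 + d) * (box_hyp_vol m.+1 e ((theta 0 + d) * s) / (s * (- ln s) ^+ m)) +
     M * (box_hyp_vol m.+1 B (c0 * s) / (s * (- ln s) ^+ m)
        - box_hyp_vol m.+1 e (c0 * s) / (s * (- ln s) ^+ m)))).
    by rewrite mulrDl -!mulrA mulrBl.
  near: s; apply: (cvgr_le _ cU).
  rewrite (_ : _ * _ = K * ((theta 0 + d) * (psi 0 + d))); last by ring.
  by rewrite (lt_trans hd1)// ltrD2l ltr_pdivrMr// ltr_pMr// ltr1n.
have lower : \forall s \near (0 : R)^'+,
    hyp_integral s \is a fin_num ->
    K * (theta 0 * psi 0) - eps <= fine (hyp_integral s) / (s * (- ln s) ^+ m).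
  have [/andP[p0 t0]|] := boolP ((0 < psi 0) && (0 < theta 0)); last first.
    move=> h; near=> s => _.
    have -> : theta 0 * psi 0 = 0.
      move: h; rewrite negb_and -!leNgt => /orP[h|h].
        by rewrite (_ : psi 0 = 0) ?mulr0//; apply/eqP; rewrite eq_le h psi0.
      by rewrite (_ : theta 0 = 0) ?mul0r//; apply/eqP; rewrite eq_le h theta0.
    rewrite mulr0 sub0r (@le_trans _ _ 0)// ?oppr_le0 ?(ltW eps0)// divr_ge0 ?fine_ge0//.
    by apply: ltW; near: s.
  have [dp dt hd3] := hd2 p0 t0.
  have cL : (psi 0 - d) * (box_hyp_vol m.+1 e ((theta 0 - d) * s) / (s * (- ln s) ^+ m))
     @[s --> 0^'+] --> (psi 0 - d) * (K * (theta 0 - d)).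
    by apply: cvgM; [exact: cvg_cst|apply: box_hyp_vol_cvg => //; rewrite subr_gt0].
  near=> s => Jfin; have s0 : 0 < s by [].
  have N0 : 0 < s * (- ln s) ^+ m by near: s.
  have := hyp_integral_ge d0 e0 eB s0 dp dt he; rewrite -(fineK Jfin) lee_fin => Js.
  rewrite ler_pdivlMr// (le_trans _ Js)// -ler_pdivlMr// -[leRHS]mulrA.
  near: s; apply: (cvgr_ge _ cL).
  rewrite (_ : (psi 0 - d) * _ = K * ((theta 0 - d) * (psi 0 - d))); last by ring.
  by rewrite (le_lt_trans _ hd3)// lerB// ler_pdivrMr// ler_pMr ?ler1n.
near=> s.
have [Jfin up] : hyp_integral s \is a fin_num /\
    fine (hyp_integral s) / (s * (- ln s) ^+ m) <= K * (theta 0 * psi 0) + eps.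
  by near: s.
have low : hyp_integral s \is a fin_num ->
    K * (theta 0 * psi 0) - eps <= fine (hyp_integral s) / (s * (- ln s) ^+ m).
  by near: s.
by rewrite distrC ler_distl up low.
Unshelve. all: end_near. Qed.

End local.

(** * Null sets and the boundary *)

Section null.
Context {R : realType}.

(** Fubini with the j-th coordinate innermost: each line parallel to that axis meets [X] in at most
    one point, a null set. The induction strips leading coordinates until [j] is the first one. *)
Lemma lebesgue_rV_null_graph n (X : set 'rV[R]_n) (j : 'I_n) : measurable X ->
  (forall x y, X x -> X y -> (forall i, i != j -> x ord0 i = y ord0 i) ->
    x ord0 j = y ord0 j) ->
  lebesgue_rV n X = 0%E.
Proof.
elim: n X j => [X [//]|n IH X j mX Xj].
have [k jk|j0] := unliftP (ord0 : 'I_n.+1) j.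
  rewrite lebesgue_rV_consE integral0_eq// => s _; apply: (IH _ k).
    exact: measurable_cons_slice.
  move=> x y Xx Xy xy; have := Xj _ _ Xx Xy; rewrite jk !cons_rVS; apply => i.
  have [l ->|->] := unliftP (ord0 : 'I_n.+1) i; last by rewrite !cons_rV0.
  by rewrite (inj_eq lift_inj) !cons_rVS; exact: xy.
have mX' : measurable ((@cons_rV R n) @^-1` X : set (measurableTypeR R * 'rV[R]_n)).
  by rewrite -[X in measurable X]setTI; exact: measurable_cons_rV.
rewrite /= /pushforward.
(* The recursive measure integrates over the first coordinate last; uniqueness of the product
   measure exchanges the order, so that the sections become subsets of the line. *)
have -> : (lebesgue_measure \x lebesgue_rV n)%E (@cons_rV R n @^-1` X) =
    product_measure2 (@lebesgue_measure R) (lebesgue_rV n) (@cons_rV R n @^-1` X).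
  apply: product_measure_unique => //= A1 A2 mA1 mA2.
  exact: product_measure2E.
rewrite /product_measure2 integral0_eq// => v _ /=.
set Y := ysection _ _.
have Y1 s t : Y s -> Y t -> s = t.
  rewrite /Y /ysection/= !inE => Xs Xt; have := Xj _ _ Xs Xt.
  rewrite j0 !cons_rV0; apply => i; have [l ->|->] := unliftP (ord0 : 'I_n.+1) i.
    by rewrite !cons_rVS.
  by rewrite eqxx.
have [[s Ys]|Y0] := pselect (exists s, Y s).
  rewrite (_ : Y = [set s]) ?lebesgue_measure_set1//.
  by apply/seteqP; split => t /=; [move=> Yt; exact: Y1|move=> ->].
rewrite (_ : Y = set0) ?measure0//.
by apply/seteqP; split => t //= Yt; apply: Y0; exists t.
Qed.

Lemma lebesgue_rV_coord0 n (j : 'I_n) :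
  lebesgue_rV n [set x : 'rV[R]_n | x ord0 j = 0] = 0%E.
Proof.
apply: (@lebesgue_rV_null_graph _ _ j) => [|x y /= -> ->//].
have := @measurable_coord _ (measurableTypeR R) n j measurableT _ (measurable_set1 (0 : R)).
by rewrite setTI.
Qed.

(** There are only countably many rational boxes, so a set that is null near each of its points is a
    countable union of null sets. The family [F] enumerates the good boxes and is empty
    elsewhere. *)
Lemma null_rat_cover n (Z : set 'rV[R]_n) : measurable Z ->
  (forall z, Z z -> exists2 q, rat_box q z & lebesgue_rV n (Z `&` rat_box q) = 0%E) ->
  lebesgue_rV n Z = 0%E.
Proof.
move=> mZ hZ.
pose F k : set 'rV[R]_n := if @choice.unpickle ('rV[rat]_n * rat)%type k is Some q then
  if pselect (lebesgue_rV n (Z `&` rat_box q) = 0%E) then Z `&` rat_box q else set0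
  else set0.
have mF k : measurable (F k).
  rewrite /F; case: (choice.unpickle k) => [q|]//.
  case: pselect => ? /=; last exact: measurable0.
  by apply: measurableI => //; exact: measurable_rat_box.
apply/eqP; rewrite eq_le measure_ge0 andbT.
have ZF : Z `<=` \bigcup_k F k.
  move=> z Zz; have [q zq q0] := hZ z Zz.
  by exists (choice.pickle q) => //; rewrite /F choice.pickleK; case: pselect.
rewrite (le_trans (le_measure _ _ _ ZF)) ?inE//; first exact: bigcupT_measurable.
rewrite (le_trans (measure_sigma_subadditive _ _ _ (@subset_refl _ _)))//.
  exact: bigcupT_measurable.
rewrite eseries0// => k _ _; rewrite /F.
case: (choice.unpickle k) => [q|]; last by rewrite measure0.
by case: pselect => /= [//|_]; rewrite measure0.
Qed.

End null.

(** * A boundary transversal to L meets L in a null set *)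

Section bnd.
Context {R : realType}.
(** The differential of the defining function kills the tangent space. If it also killed every
    coordinate direction of L it would vanish on their sum, the whole space, contrary to the
    submersion condition. So some partial derivative along L is nonzero. *)
Lemma transversal_deriv (m n : nat) (A : set 'rV[R]_(m + n)) (v : 'rV[R]_n) :
  boundary_transversal A (first_coords0 m n) -> boundary A (row_mx 0 v) ->
  exists (U : set 'rV[R]_(m + n)) (h : 'rV[R]_(m + n) -> R) (j : 'I_n),
    [/\ open U /\ U (row_mx 0 v), (forall x, U x -> differentiable h x),
     (forall x, U x -> {for x, continuous (fun x => 'D_(delta_mx ord0 (rshift m j)) h x)}),
     'D_(delta_mx ord0 (rshift m j)) h (row_mx 0 v) != 0
     & forall x, U x -> boundary A x -> h x = 0].
Proof.
move=> tr bv.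
have [|T [U [h [[oU Up sh hsub AU] ->]]] hT] := tr _ bv.
  by move=> i; rewrite row_mxEl mxE.
have [dh cdh] := sh 1%N.
have [v0 hv0] := hsub _ Up.
suff [j hj] : exists j : 'I_n, 'd h (row_mx 0 v) (delta_mx ord0 (rshift m j)) != 0.
  exists U, h, j; split => //.
  - exact: cdh.
  - by rewrite deriveE//; exact: dh.
  - move=> x Ux bx; have : (boundary A `&` U) x by [].
    by rewrite AU => -[].
apply: contrapT => /forallNP hj.
have dhp := dh _ Up.
have [t [l [/= tT lL vtl]]] := hT v0.
move: hv0; rewrite vtl linearD tT add0r => /eqP; apply.
rewrite [l]row_sum_delta linear_sum big1// => i _; rewrite linearZ/=.
case: (split_ordP i) => k ->; first by rewrite lL scale0r.
by move: (hj k) => /negP; rewrite negbK => /eqP ->; rewrite scaler0.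
Qed.

Lemma measurable_slice m n (X : set 'rV[R]_(m + n)) (x : 'rV[R]_m) : measurable X ->
  measurable [set v : 'rV[R]_n | X (row_mx x v)].
Proof.
move=> mX; rewrite -[X in measurable X]setTI.
exact: (measurableT_comp (@measurable_fun_row_mx R m n) (measurable_pair1 x)).
Qed.

Lemma measurable_boundary N (A : set 'rV[R]_N) : measurable (boundary A).
Proof.
apply: measurableD.
  by apply: closed_measurable_rV; exact: closed_closure.
by apply: open_measurable_rV; exact: open_interior.
Qed.

Lemma deriv_along_line (N : nat) (h : 'rV[R]_N -> R) (x e : 'rV[R]_N) (s : R) :
  differentiable h (x + s *: e) ->
  is_derive s 1 (fun r : R => h (x + r *: e)) ('D_e h (x + s *: e)).
Proof.
move=> dh; have dv : derivable h (x + s *: e) e by exact: diff_derivable.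
have E : (fun k : R => k^-1 *: (h (x + (k *: 1 + s) *: e) - h (x + s *: e))) =
    (fun k => k^-1 *: (h (k *: e + (x + s *: e)) - h (x + s *: e))).
  apply/funext => k; congr (_ *: (h _ - _)).
  by rewrite scalerDl addrCA /GRing.scale/= mulr1.
apply: DeriveDef; first by rewrite /derivable E.
by rewrite /derive E.
Qed.

(** Rolle's theorem: two boundary points on a line parallel to the j-th axis would give a zero of
    the j-th partial derivative of [h] between them. *)
Lemma boundary_slice_null (m n : nat) (A : set 'rV[R]_(m + n)) :
  boundary_transversal A (first_coords0 m n) ->
  lebesgue_rV n [set v | boundary A (row_mx 0 v)] = 0%E.
Proof.
move=> tr; apply: null_rat_cover.
  apply: measurable_slice; exact: measurable_boundary.
move=> v bv.
have [U [h [j [[oU Up] dh cdh dhp bh]]]] := transversal_deriv tr bv.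
set e := delta_mx _ _ in cdh dhp.
have : \forall x \near nbhs (row_mx 0 v : 'rV[R]_(m + n)), U x /\ 'D_e h x != 0.
  apply: filterI; first exact: open_nbhs_nbhs.
  exact: (@cvgr_neq0 _ _ _ (nbhs _) _ _ _ (cdh _ Up) dhp).
move=> /nbhs_rVP[d d0 hd].
have [q qv qd] := rat_box_nbhs v d0.
have hq y : rat_box q y -> U (row_mx 0 y) /\ 'D_e h (row_mx 0 y) != 0.
  move=> /qd yv; apply: hd => i.
  case: (split_ordP i) => k ->; first by rewrite !row_mxEl !mxE subrr normr0.
  by rewrite !row_mxEr.
exists q => //; apply: (@lebesgue_rV_null_graph _ _ _ j).
  apply: measurableI; last exact: measurable_rat_box.
  apply: measurable_slice; exact: measurable_boundary.
move=> x y [bx qx] [by_ qy] xy.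
wlog xlty : x y bx qx by_ qy xy / x ord0 j <= y ord0 j.
  move=> w; have [le|/ltW le] := leP (x ord0 j) (y ord0 j); first exact: w.
  by apply/esym/w => // i ij; rewrite xy.
apply/eqP; rewrite eq_le xlty/= leNgt; apply/negP => lt.
pose g (r : R) := h (row_mx 0 x + r *: e).
pose a := y ord0 j - x ord0 j.
have a0 : 0 < a by rewrite subr_gt0.
have line r : row_mx 0 x + r *: e = row_mx 0 (x + r *: delta_mx ord0 j).
  apply/rowP => i; rewrite /e [LHS]mxE [X in _ + X]mxE; case: (split_ordP i) => k ->.
    by rewrite !row_mxEl !mxE eqxx/= add0r eq_lrshift mulr0.
  by rewrite !row_mxEr !mxE !eqxx/= eq_rshift.
have yE : y = x + a *: delta_mx ord0 j.
  apply/rowP => i; rewrite !mxE eqxx/=; have [->|ij] := eqVneq i j.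
    by rewrite mulr1 addrC subrK.
  by rewrite mulr0 addr0 xy.
(* The box is convex, so the whole segment stays where the derivative does not vanish. *)
have qr r : 0 <= r <= a -> rat_box q (x + r *: delta_mx ord0 j).
  move=> /andP[r0 ra] i; rewrite !mxE eqxx/=; have [->|ij] := eqVneq i j; last first.
    by rewrite mulr0 addr0; exact: qx.
  rewrite mulr1; have := qx j; have := qy j; rewrite !ltr_norml => /andP[y1 y2] /andP[x1 x2].
  apply/andP; split; rewrite /a in ra; lra.
have dg r : 0 <= r <= a -> is_derive r 1 g ('D_e h (row_mx 0 x + r *: e)).
  move=> /qr/hq[Ur _]; apply: deriv_along_line; rewrite line; exact: dh.
have [|||c] := @Rolle _ g 0 a a0.
- move=> r; rewrite in_itv/= => /andP[/ltW r0 /ltW ra].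
  by have [] := dg r (ltac:(by rewrite r0 ra)).
- apply: continuous_in_subspaceT => r; rewrite inE/= in_itv/= => /dg[dr _].
  by apply: differentiable_continuous; exact/derivable1_diffP.
- rewrite /g !line scale0r addr0 -yE.
  by rewrite (bh _ (hq _ qx).1 bx) (bh _ (hq _ qy).1 by_).
- rewrite in_itv/= => /andP[/ltW c0 /ltW ca] [_ dc].
  have c0a : 0 <= c <= a by rewrite c0 ca.
  have [_] := dg _ c0a; rewrite dc line => Dh0.
  by have [_] := hq _ (qr _ c0a); rewrite -Dh0 eqxx.
Qed.

End bnd.

(** * Integrability of negative powers *)

Section power.
Context {R : realType}.

(** Cutting off at [B], the bound on the coordinates in [Omega], makes the power integrable over the
    whole line for a < 1, so the dominating function can live on all of R^n. *)
Definition trunc_pow (a B s : R) : R := if `|s| <= B then `|s| `^ (- a) else 0.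

Lemma trunc_pow_ge0 a B s : 0 <= trunc_pow a B s.
Proof. by rewrite /trunc_pow; case: ifP => // _; exact: powR_ge0. Qed.

Lemma measurable_trunc_pow a B : measurable_fun [set: R] (trunc_pow a B).
Proof.
apply: measurable_fun_ifT => //.
- apply: measurable_fun_ler => //; exact: normr_measurable.
- apply: (measurableT_comp (measurable_powR (- a))); exact: normr_measurable.
Qed.

Lemma continuous_powR (b x : R) : 0 < x -> {for x, continuous (@powR R ^~ b)}.
Proof.
move=> x0; apply: differentiable_continuous; apply/derivable1_diffP.
by have [] := is_derive1_powR b x0.
Qed.

(** The primitive at [e] is nonnegative and is dropped, so the bound is uniform in [e] and survives
    monotone exhaustion. *)
Lemma integral_powR_lt (a e B : R) : a < 1 -> 0 < e -> e < B ->
  (\int[lebesgue_measure]_(s in `[e, B]) (s `^ (- a))%:E <=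
   (B `^ (1 - a) / (1 - a))%:E)%E.
Proof.
move=> a1 e0 eB.
have a10 : 0 < 1 - a by rewrite subr_gt0.
pose F (s : R) := (1 - a)^-1 * s `^ (1 - a).
have dF (x : R) : 0 < x -> is_derive x 1 F (x `^ (- a)).
  move=> x0; rewrite (_ : F = (1 - a)^-1 *: (@powR R ^~ (1 - a))); last by [].
  apply: is_derive_eq; first by apply: is_deriveZ; exact: is_derive1_powR.
  rewrite /GRing.scale/= mulrA mulVf ?gt_eqF// mul1r; congr (_ `^ _); ring.
have cF (x : R) : 0 < x -> {for x, continuous F}.
  move=> x0; apply: differentiable_continuous; apply/derivable1_diffP.
  by have [] := dF _ x0.
rewrite (@continuous_FTC2 _ (fun s => s `^ (- a)) F)//.
- by rewrite -EFinB lee_fin /F mulrC lerBlDr lerDl mulr_ge0 ?powR_ge0// invr_ge0 ltW.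
- apply: continuous_in_subspaceT => x; rewrite inE/= in_itv/= => /andP[ex _].
  by apply: continuous_powR; exact: lt_le_trans ex.
- split.
  + by move=> x; rewrite in_itv/= => /andP[ex _]; have [] := dF x (lt_trans e0 ex).
  + by apply: cvg_at_right_filter; apply: cF.
  + by apply: cvg_at_left_filter; apply: cF; exact: lt_trans eB.
- move=> x; rewrite in_itv/= => /andP[ex _]; rewrite derive1E.
  by have [_] := dF x (lt_trans e0 ex).
Qed.

Lemma integral_trunc_pow_lty (a B : R) : a < 1 -> 0 < B ->
  (\int[lebesgue_measure]_s (trunc_pow a B s)%:E < +oo)%E.
Proof.
move=> a1 B0.
rewrite ge0_integral_even; last 3 first.
- by apply/measurable_EFinP; exact: measurable_trunc_pow.
- by move=> x; rewrite lee_fin trunc_pow_ge0.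
- by move=> x; rewrite /trunc_pow normrN.
rewrite lte_mul_pinfty ?lee_fin//.
have -> : `]0, +oo[%classic = `]0, B] `|` `]B, +oo[ :> set R.
  by rewrite -itv_bndbnd_setU ?bnd_simp// ltW.
have mt (D : set R) : measurable_fun D (fun s => (trunc_pow a B s)%:E).
  by apply: measurable_funTS; apply/measurable_EFinP; exact: measurable_trunc_pow.
rewrite ge0_integral_setU//=; last 3 first.
- exact: mt.
- by move=> x _; rewrite lee_fin trunc_pow_ge0.
- by apply/disj_setPS => x /= []; rewrite !in_itv/= andbT => /andP[_]; rewrite leNgt => /negP.
rewrite [X in (_ + X)%E](@integral0_eq); last first.
  move=> x /=; rewrite in_itv/= andbT => Bx; rewrite /trunc_pow ifF//.
  by apply/negbTE; rewrite -ltNge (lt_le_trans Bx)// ler_norm.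
rewrite adde0.
(* With [k.+2] the left endpoint is strictly below [B] already at k = 0, as [integral_powR_lt]
   requires. *)
pose F (k : nat) : set R := `[B / k.+2%:R, B]%classic.
have -> : `]0, B]%classic = \bigcup_k F k :> set R.
  apply/seteqP; split => x /=.
    rewrite in_itv/= => /andP[x0 xB].
    exists (Num.truncn (B / x)) => //; rewrite /F/= in_itv/= xB andbT.
    rewrite ler_pdivrMr ?ltr0n// mulrC -ler_pdivrMr//.
    rewrite (le_trans (ltW (truncnS_gt _)))// ler_nat; exact: leqnSn.
  move=> [k _]; rewrite /F/= !in_itv/= => /andP[kx ->]; rewrite andbT.
  by rewrite (lt_le_trans _ kx)// divr_gt0.
apply: (@le_lt_trans _ _ (B `^ (1 - a) / (1 - a))%:E); last by rewrite ltry.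
have cF := @ge0_nondecreasing_set_cvg_integral _ (measurableTypeR R) R F
  (fun s => (trunc_pow a B s)%:E) lebesgue_measure.
have {}cF : (\int[lebesgue_measure]_(x in F i) (trunc_pow a B x)%:E @[i --> \oo] -->
   \int[lebesgue_measure]_(x in \bigcup_i F i) (trunc_pow a B x)%:E)%E.
  apply: cF => //.
  - move=> i j ij; rewrite subsetEset => x; rewrite /F/= !in_itv/= => /andP[ix ->].
    rewrite andbT (le_trans _ ix)// ler_wpM2l ?(ltW B0)// lef_pV2 ?posrE ?ltr0n// ler_nat.
    by rewrite !ltnS.
  - by move=> i; exact: measurable_itv.
  - by move=> i; exact: mt.
  - by move=> i x _; rewrite lee_fin trunc_pow_ge0.
rewrite -(cvg_lim _ cF)//; apply: lime_le; first by apply/cvg_ex; eexists; exact: cF.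
apply: nearW => k /=.
have k0 : 0 < B / k.+2%:R by rewrite divr_gt0.
rewrite (@eq_integral _ (measurableTypeR R) R _ _ (fun s : R => (s `^ (- a))%:E)); last first.
  move=> s /set_mem; rewrite /F/= in_itv/= => /andP[ks sB].
  by rewrite /trunc_pow gtr0_norm ?sB// (lt_le_trans k0).
apply: integral_powR_lt => //.
by rewrite ltr_pdivrMr// ltr_pMr// ltr1n.
Qed.

Lemma measurable_prod_trunc_pow n (a : 'I_n -> R) B :
  measurable_fun [set: 'rV[R]_n] (fun y => \prod_j trunc_pow (a j) B (y ord0 j)).
Proof.
apply: measurable_prod => j _.
by apply: (measurableT_comp (measurable_trunc_pow (a j) B)); exact: measurable_coord.
Qed.

Lemma integral_prod_trunc_pow_lty n (a : 'I_n -> R) (B : R) :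
  (forall j, a j < 1) -> 0 < B ->
  (\int[lebesgue_rV n]_y (\prod_j trunc_pow (a j) B (y ord0 j))%:E < +oo)%E.
Proof.
move=> a1 B0; elim: n a a1 => [|n IH] a a1.
  under eq_integral do rewrite big_ord0.
  by rewrite integral_cst//= diracT mul1e ltry.
have p0 k (b : 'I_k -> R) (y : 'rV[R]_k) :
    (0 <= (\prod_j trunc_pow (b j) B (y ord0 j))%:E)%E.
  by rewrite lee_fin; apply: prodr_ge0 => j _; exact: trunc_pow_ge0.
rewrite ge0_integral_cons_rV//; last first.
  by apply/measurable_EFinP; exact: measurable_prod_trunc_pow.
under eq_integral => s _.
  under eq_integral => v _.
    rewrite big_ord_recl cons_rV0.
    under eq_bigr do rewrite cons_rVS.
    rewrite EFinM.
    over.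
  rewrite ge0_integralZl//; last 2 first.
  - by apply/measurable_EFinP; exact: measurable_prod_trunc_pow.
  - by rewrite lee_fin trunc_pow_ge0.
  rewrite muleC.
  over.
have I0 : (0 <= \int[lebesgue_rV n]_v (\prod_j trunc_pow (a (lift ord0 j)) B (v ord0 j))%:E)%E.
  by apply: integral_ge0 => v _.
rewrite ge0_integralZl//; last 2 first.
- by apply/measurable_EFinP; exact: measurable_trunc_pow.
- by move=> x _; rewrite lee_fin trunc_pow_ge0.
rewrite lte_mul_pinfty//.
- by rewrite ge0_fin_numE//; exact: IH.
- exact: integral_trunc_pow_lty.
Qed.

End power.

(** * Dominated convergence over the fibers *)

Section core.
Context {R : realType}.

Lemma powR_prod (I : Type) (r : seq I) (F : I -> R) (p : R) :
  (forall i, 0 <= F i) -> (\prod_(i <- r) F i) `^ p = \prod_(i <- r) F i `^ p.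
Proof.
move=> F0; elim: r => [|i r IH]; first by rewrite !big_nil powR1.
by rewrite !big_cons powRM// ?IH// prodr_ge0.
Qed.

Lemma ler_powR2r (a b p : R) : 0 <= a -> 0 <= b -> 0 < p ->
  (a `^ p <= b `^ p) = (a <= b).
Proof.
move=> a0 b0 p0; apply/idP/idP => [|ab]; last exact: (ge0_ler_powR (ltW p0)).
by apply: contraTT; rewrite -!ltNge => ba; exact: (gt0_ltr_powR p0).
Qed.

Lemma powR_le_opp (a b p : R) : 0 < a -> a <= b -> 0 <= p -> b `^ (- p) <= a `^ (- p).
Proof.
move=> a0 ab p0; have b0 := lt_le_trans a0 ab.
rewrite !powRN lef_pV2 ?posrE ?powR_gt0//.
by apply: ge0_ler_powR => //; rewrite nnegrE ltW.
Qed.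

(* Z is the set of the y for which (0, y) is a boundary point of Omega. *)
Variables (m n : nat) (Omega : set 'rV[R]_(m.+1 + n))
  (f g phi : 'rV[R]_(m.+1 + n) -> R) (kappa : 'I_(m.+1 + n) -> nat)
  (ell B M g0 : R) (Z : set 'rV[R]_n).
Hypotheses (ell_gt0 : 0 < ell)
  (kappa_first : forall i : 'I_m.+1, (kappa (lshift n i))%:R = ell^-1)
  (kappa_last : forall j : 'I_n, (kappa (rshift m.+1 j))%:R < ell^-1)
  (mOmega : measurable Omega)
  (B_ge1 : 1 <= B) (OmegaB : forall w, Omega w -> forall i, `|w ord0 i| <= B)
  (mg : measurable_fun Omega g) (mphi : measurable_fun Omega phi)
  (g0_gt0 : 0 < g0) (g_ge : forall w, Omega w -> g0 <= g w)
  (M_gt0 : 0 < M) (phi_le : forall w, Omega w -> phi w <= M)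
  (phi_ge0 : forall w, Omega w -> 0 <= phi w)
  (fE : forall w, Omega w -> f w = (\prod_i w ord0 i ^+ kappa i) * g w)
  (mZ : measurable Z) (Z0 : lebesgue_rV n Z = 0%E)
  (cg : forall y, ~ Z y ->
    {for row_mx 0 y, continuous ((fun w => g w `^ (- ell)) \_ Omega)%R})
  (cphi : forall y, ~ Z y -> {for row_mx 0 y, continuous (phi \_ Omega)%R}).

Let gl (w : 'rV[R]_(m.+1 + n)) : R := g w `^ (- ell).
Let kl (j : 'I_n) : R := ell * (kappa (rshift m.+1 j))%:R.
Let Py (y : 'rV[R]_n) : R := \prod_(j < n) `|y ord0 j| ^+ kappa (rshift m.+1 j).
Let Pl (y : 'rV[R]_n) : R := \prod_(j < n) `|y ord0 j| `^ (- kl j).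
Let k := kappa (lshift n ord0).
Let K : R := 2 ^+ m.+1 / m`!%:R.

Definition level_set (lam : R) : set 'rV[R]_(m.+1 + n) :=
  [set w | Omega w /\ `|f w| <= lam].

Let theta y (x : 'rV[R]_m.+1) : R := Pl y * (gl \_ Omega) (row_mx x y).
Let psi y (x : 'rV[R]_m.+1) : R := (phi \_ Omega) (row_mx x y).
Let phi_lev lam (w : 'rV[R]_(m.+1 + n)) : \bar R := ((EFin \o phi) \_ (level_set lam)) w.
Let fiber lam (y : 'rV[R]_n) : \bar R := (\int[lebesgue_rV m.+1]_x phi_lev lam (row_mx x y))%E.
Let scale (lam : R) : R := lam `^ ell * (- ln lam) ^+ m.
Let generic (y : 'rV[R]_n) := forall j, y ord0 j != 0.

Let B_gt0 : 0 < B. Proof. exact: lt_le_trans B_ge1. Qed.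

Lemma measurable_monomial : measurable_fun [set: 'rV[R]_(m.+1 + n)]
  (fun w => \prod_i w ord0 i ^+ kappa i).
Proof.
apply: measurable_prod => i _; apply: measurable_funX.
exact: (@measurable_coord _ (measurableTypeR R)).
Qed.

Lemma measurable_level_set lam : measurable (level_set lam).
Proof.
apply: (@measurable_fun_le _ _ R Omega _ _ mOmega) => //.
apply: (measurableT_comp (@normr_measurable R setT)).
apply: (@eq_measurable_fun _ _ _ _ Omega
  (fun w : 'rV[R]_(m.+1 + n) => (\prod_i w ord0 i ^+ kappa i) * g w)).
  by move=> w; rewrite inE => Ow; rewrite fE.
apply: measurable_funM => //; apply: measurable_funTS; exact: measurable_monomial.
Qed.

Lemma measurable_phi_lev lam : measurable_fun [set: 'rV[R]_(m.+1 + n)] (phi_lev lam).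
Proof.
apply/(measurable_restrictT _ (measurable_level_set lam)).
apply/measurable_EFinP; apply: measurable_funS mphi => //.
by move=> w [].
Qed.

Lemma phi_lev_ge0 lam w : (0 <= phi_lev lam w)%E.
Proof.
rewrite /phi_lev /patch; case: ifPn => // /set_mem[Ow _]; by rewrite lee_fin phi_ge0.
Qed.

Lemma normr_fE x y : Omega (row_mx x y) ->
  `|f (row_mx x y)| = (\prod_i `|x ord0 i|) ^+ k * (Py y * g (row_mx x y)).
Proof.
move=> Ow; rewrite fE// normrM [X in _ * X]gtr0_norm; last exact: lt_le_trans (g_ge Ow).
rewrite normr_prod big_split_ord/= -mulrA; congr (_ * (_ * _)).
  rewrite -prodrXl; apply: eq_bigr => i _; rewrite row_mxEl normrX; congr (_ ^+ _).
  by apply/eqP; rewrite -(eqr_nat R) !kappa_first.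
by apply: eq_bigr => j _; rewrite row_mxEr normrX.
Qed.

Lemma Py_gt0 y : generic y -> 0 < Py y.
Proof. by move=> y0; apply: prodr_gt0 => j _; rewrite exprn_gt0// normr_gt0. Qed.

Lemma PlE y : Pl y = Py y `^ (- ell).
Proof.
rewrite /Py powR_prod; last by move=> j; rewrite exprn_ge0.
by apply: eq_bigr => j _; rewrite -powR_mulrn// -powRrM mulrN mulrC.
Qed.

Lemma Pl_gt0 y : generic y -> 0 < Pl y.
Proof. by move=> y0; rewrite PlE powR_gt0// Py_gt0. Qed.

Lemma Pl_ge0 y : 0 <= Pl y.
Proof. by rewrite PlE powR_ge0. Qed.

(** Since k = 1 / ell, raising both sides to the power [ell] leaves the plain product of the
    |x_i|. *)
Lemma level_setE lam x y : generic y -> 0 < lam -> Omega (row_mx x y) ->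
  (`|f (row_mx x y)| <= lam) =
  (\prod_i `|x ord0 i| <= lam `^ ell * (Pl y * gl (row_mx x y))).
Proof.
move=> y0 l0 Ow; rewrite normr_fE//.
have gw : 0 < g (row_mx x y) by exact: lt_le_trans (g_ge Ow).
set a := \prod_i _; have a0 : 0 <= a by apply: prodr_ge0 => i _.
have c0 : 0 < Py y * g (row_mx x y) by rewrite mulr_gt0 ?Py_gt0.
rewrite -ler_pdivlMr// -(@ler_powR2r _ _ ell) ?exprn_ge0 ?divr_ge0 ?(ltW l0) ?(ltW c0)//.
rewrite -powR_mulrn// -powRrM kappa_first mulVf ?gt_eqF// powRr1//.
rewrite powRM ?(ltW l0) ?invr_ge0 ?(ltW c0)//.
congr (_ <= _ * _).
by rewrite PlE -powRM ?(ltW (Py_gt0 y0)) ?(ltW gw)// -powR_inv1 ?(ltW c0)// -powRrM mulN1r.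
Qed.

(** Points of the hyperbolic domain outside [Omega] may satisfy its inequality, with product 0, but
    [psi] vanishes there. *)
Lemma fiberE lam y : generic y -> 0 < lam ->
  fiber lam y = (\int[lebesgue_rV m.+1]_(x in hyp_set (theta y) B (lam `^ ell)) (psi y x)%:E)%E.
Proof.
move=> y0 l0; rewrite /fiber [RHS]integral_mkcond; apply: eq_integral => x _.
rewrite /phi_lev /patch /psi /patch.
have [Ow|Ow] := pselect (Omega (row_mx x y)); last first.
  rewrite memNset; last by move=> [].
  by rewrite [row_mx x y \in Omega]memNset//; case: ifP.
rewrite [row_mx x y \in Omega]mem_set//=.
have -> : (row_mx x y \in level_set lam) = (x \in hyp_set (theta y) B (lam `^ ell)); last by [].
apply/idP/idP => /set_mem.
  move=> [_ fl]; apply/mem_set; split.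
    by move=> i; have := OmegaB Ow (lshift n i); rewrite row_mxEl.
  by rewrite /theta /patch mem_set// -level_setE.
move=> [_ xl]; apply/mem_set; split=> //.
by move: xl; rewrite /theta /patch mem_set// -level_setE.
Qed.

Lemma measurable_row (y : 'rV[R]_n) :
  measurable_fun [set: 'rV[R]_m.+1] (fun x => row_mx x y : 'rV[R]_(m.+1 + n)).
Proof. exact: (measurableT_comp (@measurable_fun_row_mx R m.+1 n) (measurable_pair2 y)). Qed.

Lemma measurable_gl : measurable_fun [set: 'rV[R]_(m.+1 + n)] (gl \_ Omega)%R.
Proof.
apply/(measurable_restrictT _ mOmega).
exact: (measurableT_comp (measurable_powR (- ell))).
Qed.

Lemma measurable_theta y : measurable_fun [set: 'rV[R]_m.+1] (theta y).
Proof.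
apply: measurable_funM => //.
exact: (measurableT_comp measurable_gl (measurable_row y)).
Qed.

Lemma measurable_psi y : measurable_fun [set: 'rV[R]_m.+1] (psi y).
Proof.
apply: (measurableT_comp _ (measurable_row y)).
by apply/(measurable_restrictT _ mOmega).
Qed.

Lemma psi_bounds y x : 0 <= psi y x <= M.
Proof.
rewrite /psi /patch; case: ifPn => [/set_mem Ow|_]; last by rewrite lexx ltW.
by rewrite phi_ge0// phi_le.
Qed.

Lemma theta_bounds y x : 0 <= theta y x <= Pl y * g0 `^ (- ell).
Proof.
rewrite /theta /patch mulr_ge0 ?Pl_ge0//=; last by case: ifP => // _; exact: powR_ge0.
rewrite ler_wpM2l ?Pl_ge0//; case: ifPn => [/set_mem Ow|_]; last exact: powR_ge0.
by apply: powR_le_opp => //; [exact: g_ge|exact: ltW].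
Qed.

Lemma row_continuous (h : 'rV[R]_(m.+1 + n) -> R) y :
  {for row_mx 0 y, continuous h} ->
  {for 0, continuous (fun x : 'rV[R]_m.+1 => h (row_mx x y))}.
Proof.
move=> ch; apply: (@continuous_comp _ _ _ (fun x : 'rV[R]_m.+1 => row_mx x y) h) => //.
move=> A /nbhs_rVP[e e0 eA]; apply/nbhs_rVP; exists e => // x xe.
apply: eA => i; case: (split_ordP i) => j ->; last by rewrite !row_mxEr subrr normr0.
by rewrite !row_mxEl; exact: xe.
Qed.

(** The factor ell^m comes from (-ln s)^m = ell^m (-ln lambda)^m for s = lambda^ell. *)
Let limit_density y : R := ell ^+ m * K * (theta y 0 * psi y 0).

Lemma fiber_cvg y : generic y -> ~ Z y ->
  fine (fiber lam y) / scale lam @[lam --> 0^'+] --> limit_density y.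
Proof.
move=> y0 Zy.
have cpsi : {for 0, continuous (psi y)} by apply: row_continuous; exact: cphi.
have ctheta : {for 0, continuous (theta y)}.
  have := row_continuous (cg Zy) => h.
  change (theta y x @[x --> (0 : 'rV[R]_m.+1)] --> theta y 0).
  have hc : (fun=> Pl y) x @[x --> (0 : 'rV[R]_m.+1)] --> Pl y.
    exact: cst_continuous.
  exact: (cvgM hc h).
have c0 : 0 < Pl y * g0 `^ (- ell) by rewrite mulr_gt0 ?Pl_gt0 ?powR_gt0.
have h := @hyp_integral_cvg R m (psi y) (theta y) M _ B (measurable_psi y) (measurable_theta y)
  (fun x => proj1 (andP (psi_bounds y x))) (fun x => proj2 (andP (psi_bounds y x)))
  (fun x => proj1 (andP (theta_bounds y x))) (fun x => proj2 (andP (theta_bounds y x)))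
  c0 B_gt0 cpsi ctheta.
have pl : lam `^ ell @[lam --> (0:R)^'+] --> (0:R)^'+.
  move=> A [e /= e0 eA].
  have := @powR_cvg0 R ell ell_gt0; move=> /cvgrPdist_lt /(_ _ e0) near_e.
  suff : \forall lam \near (0 : R)^'+, A (lam `^ ell) by [].
  near=> lam.
  have l0 : 0 < lam by [].
  have lp : 0 < lam `^ ell by exact: powR_gt0.
  by apply: (eA (lam `^ ell)) => //=; near: lam.
have {}h := cvg_comp _ _ pl h.
have {}h : ell ^+ m * (fine (\int[lebesgue_rV m.+1]_(x in hyp_set (theta y) B (lam `^ ell))
      (psi y x)%:E) / (lam `^ ell * (- ln (lam `^ ell)) ^+ m)) @[lam --> (0 : R)^'+] -->
    ell ^+ m * (K * (theta y 0 * psi y 0)).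
  by apply: cvgM; [exact: cvg_cst|exact: h].
rewrite /limit_density -[ell ^+ m * K * _]mulrA; apply: cvg_trans h.
apply: near_eq_cvg; near=> lam.
have l0 : 0 < lam by [].
rewrite /= fiberE// /scale ln_powR.
have ln0 : 0 < - ln lam.
  rewrite oppr_gt0 ln_lt0// l0/=; near: lam; exact: nbhs_right_lt.
rewrite -mulrN exprMn; field.
by rewrite !expf_neq0 ?gt_eqF// powR_gt0.
Unshelve. all: end_near. Qed.

(* A1 bounds ln (B ^+ m.+1 / t) / (- ln lam) for lam < 1 / e, where
   t = Pl y * g0 `^ (- ell) * lam `^ ell. *)
Let LB : R := ln (B ^+ (\sum_(j < n) kappa (rshift m.+1 j))%N).
Let A1 : R := `|ln (B ^+ m.+1)| + ell * `|ln g0| + ell * LB + ell + 1.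
Definition dom_cst : R := M * (2 ^+ m.+1 * (m.+1%:R * A1 ^+ m) * g0 `^ (- ell)).
Let dominator (y : 'rV[R]_n) : R := dom_cst * \prod_j trunc_pow (kl j) B (y ord0 j).

(** Bounding [psi] by [M] and [theta] by Pl(y) g0^(-ell) reduces the fiber to a hyperbolic box,
    whose volume is linear in Pl(y) up to logarithms. For y outside the cube the fiber is empty. *)
Lemma fiber_le lam y : generic y -> 0 < lam -> lam < expR (-1) ->
  (fiber lam y <= (scale lam * dominator y)%:E)%E.
Proof.
move=> y0 l0 le1.
have T1 : 1 <= - ln lam.
  by rewrite lerNr -ler_expR lnK ?posrE// ltW.
have LB0 : 0 <= LB by rewrite ln_ge0// exprn_ege1.
have A10 : 1 <= A1.
  by rewrite lerDr !addr_ge0 ?mulr_ge0 ?(ltW ell_gt0).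
have N0 : 0 <= scale lam by rewrite mulr_ge0 ?powR_ge0// exprn_ge0// (le_trans ler01).
have D0 : 0 <= dom_cst.
  by rewrite !mulr_ge0 ?exprn_ge0 ?powR_ge0 ?(ltW M_gt0) ?(le_trans ler01 A10).
have G0 : 0 <= dominator y.
  by rewrite mulr_ge0// prodr_ge0// => j _; exact: trunc_pow_ge0.
have [yB|] := pselect (forall j, `|y ord0 j| <= B); last first.
  move=> /existsNP[j /negP]; rewrite -ltNge => yB.
  rewrite /fiber integral0_eq; first by rewrite lee_fin (mulr_ge0 N0 G0).
  move=> x _; rewrite /phi_lev /patch memNset// => -[Ow _].
  by have := OmegaB Ow (rshift m.+1 j); rewrite row_mxEr leNgt yB.
have GE : dominator y = dom_cst * Pl y.
  by congr (_ * _); apply: eq_bigr => j _; rewrite /trunc_pow yB.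
set s := lam `^ ell; have s0 : 0 < s by exact: powR_gt0.
set c := Pl y * g0 `^ (- ell).
have c0 : 0 < c by rewrite mulr_gt0 ?Pl_gt0 ?powR_gt0.
have cs0 : 0 < c * s by rewrite mulr_gt0.
have mb : measurable (@box_hyp R m.+1 B (c * s)) by exact: measurable_box_hyp.
apply: (@le_trans _ _ (M * box_hyp_vol m.+1 B (c * s))%:E).
  rewrite EFinM -lebesgue_box_hyp// (integral_scaled_indic mb (ltW M_gt0)).
  rewrite fiberE// [leLHS]integral_mkcond; apply: ge0_le_integral => //.
  - move=> x _; rewrite /patch; case: ifP => // _; rewrite lee_fin.
    by have /andP[] := psi_bounds y x.
  - apply/(measurable_restrictT _ (measurable_hyp_set _ (measurable_theta y) _)).
    by apply: measurable_funTS; apply/measurable_EFinP; exact: measurable_psi.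
  - exact: measurable_scaled_indic.
  move=> x _; rewrite /patch; case: ifPn => [/set_mem[xB xs]|_]; last first.
    by rewrite lee_fin mulr_ge0 ?(ltW M_gt0)// indicE.
  rewrite lee_fin indicE mem_set ?mulr1; first by have /andP[] := psi_bounds y x.
  split=> //; rewrite (le_trans xs)// mulrC ler_wpM2r ?(ltW s0)//.
  by have /andP[] := theta_bounds y x.
rewrite lee_fin GE.
(* Here -ln Pl(y) = ell ln Py(y), which is bounded above on the cube by ell LB, however close y is
   to a coordinate hyperplane. *)
have DT : ln (B ^+ m.+1 / (c * s)) <= A1 * - ln lam.
  rewrite ln_div ?posrE ?exprn_gt0// lnM ?posrE//.
  rewrite /c lnM ?posrE ?Pl_gt0 ?powR_gt0// PlE /s !ln_powR.
  have lP : ln (Py y) <= LB.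
    rewrite ler_ln ?posrE ?Py_gt0 ?exprn_gt0// -prodrXr; apply: ler_prod => j _.
    by rewrite exprn_ge0//= lerXn2r ?nnegrE// ltW.
  have lP2 : ell * ln (Py y) <= ell * LB by rewrite ler_wpM2l// ltW.
  have lg : ell * ln g0 <= ell * `|ln g0| by rewrite ler_wpM2l ?ler_norm// ltW.
  have lB := ler_norm (ln (B ^+ m.+1)).
  (* Since -ln lam >= 1, the constant terms are absorbed into a multiple of -ln lam. *)
  have e1 : 0 <= (`|ln (B ^+ m.+1)| + ell * `|ln g0| + ell * LB) * (- ln lam - 1).
    by rewrite mulr_ge0 ?subr_ge0// !addr_ge0 ?mulr_ge0 ?(ltW ell_gt0).
  rewrite /A1; lra.
have A1T : 1 <= A1 * - ln lam by rewrite mulr_ege1.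
have := @box_hyp_vol_le R m.+1 B (c * s) _ isT B_gt0 cs0 A1T DT.
move=> /(ler_wpM2l (ltW M_gt0)) /le_trans; apply.
rewrite le_eqVlt; apply/orP; left; apply/eqP.
rewrite /dom_cst /scale /c /s/= exprMn; ring.
Qed.

Lemma ae_generic : {ae lebesgue_rV n, forall y, generic y /\ ~ Z y}.
Proof.
have a1 : {ae lebesgue_rV n, forall y, generic y}.
  apply: filter_forall => j.
  exists [set y : 'rV[R]_n | y ord0 j = 0]; split.
  - have := @measurable_coord _ (measurableTypeR R) n j measurableT _ (measurable_set1 (0 : R)).
    by rewrite setTI.
  - exact: lebesgue_rV_coord0.
  - by move=> y /= /negP; rewrite negbK => /eqP.
have a2 : {ae lebesgue_rV n, forall y, ~ Z y}.
  by exists Z; split => // y /= /contrapT.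
by apply: filterS2 a1 a2 => y.
Qed.

Lemma measurable_limit_density : measurable_fun [set: 'rV[R]_n] limit_density.
Proof.
have mrow : measurable_fun [set: 'rV[R]_n]
    (fun y => row_mx (0 : 'rV[R]_m.+1) y : 'rV[R]_(m.+1 + n)).
  exact: (measurableT_comp (@measurable_fun_row_mx R m.+1 n) (measurable_pair1 _)).
apply: measurable_funM => //; apply: measurable_funM; first apply: measurable_funM.
- apply: measurable_prod => j _; apply: (measurableT_comp (measurable_powR _)).
  exact: measurable_normr_coord.
- exact: (measurableT_comp measurable_gl mrow).
- apply: (measurableT_comp _ mrow); exact/(measurable_restrictT _ mOmega).
Qed.

Lemma measurable_fiber lam : measurable_fun [set: 'rV[R]_n] (fiber lam).
Proof.
apply: (@measurable_fun_fubini_tonelli_G _ _ _ _ _ (lebesgue_rV m.+1)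
    (fun p : 'rV[R]_m.+1 * 'rV[R]_n => phi_lev lam (row_mx p.1 p.2))).
- exact: (measurableT_comp (measurable_phi_lev lam) (@measurable_fun_row_mx R m.+1 n)).
- by move=> p; exact: phi_lev_ge0.
Qed.

Lemma fiber_ge0 lam y : (0 <= fiber lam y)%E.
Proof. by apply: integral_ge0 => x _; exact: phi_lev_ge0. Qed.

Lemma kl_lt1 j : kl j < 1.
Proof. by rewrite /kl mulrC -ltr_pdivlMr// div1r kappa_last. Qed.

Lemma dom_cst_ge0 : 0 <= dom_cst.
Proof.
have LB0 : 0 <= LB by rewrite ln_ge0// exprn_ege1.
by rewrite !mulr_ge0 ?exprn_ge0 ?powR_ge0 ?(ltW M_gt0)// !addr_ge0 ?mulr_ge0 ?(ltW ell_gt0).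
Qed.

Lemma dominator_integrable : (lebesgue_rV n).-integrable setT (EFin \o dominator).
Proof.
have mG : measurable_fun [set: 'rV[R]_n] dominator.
  by apply: measurable_funM => //; exact: measurable_prod_trunc_pow.
apply/integrableP; split; first exact/measurable_EFinP.
have p0 (y : 'rV[R]_n) : 0 <= \prod_j trunc_pow (kl j) B (y ord0 j).
  by apply: prodr_ge0 => j _; exact: trunc_pow_ge0.
rewrite (eq_integral (fun y : 'rV[R]_n =>
    (dom_cst%:E * (\prod_j trunc_pow (kl j) B (y ord0 j))%:E)%E)); last first.
  by move=> y _; rewrite /= ger0_norm// mulr_ge0// dom_cst_ge0.
rewrite ge0_integralZl//; last 3 first.
- by apply/measurable_EFinP; exact: measurable_prod_trunc_pow.
- by move=> y _; rewrite lee_fin.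
- by rewrite lee_fin dom_cst_ge0.
rewrite lte_mul_pinfty ?lee_fin ?dom_cst_ge0//.
by apply: integral_prod_trunc_pow_lty => //; exact: kl_lt1.
Qed.

Lemma scale_gt0 lam : 0 < lam -> lam < expR (-1) -> 0 < scale lam.
Proof.
move=> l0 le1; rewrite mulr_gt0 ?powR_gt0// exprn_gt0//.
by rewrite (@lt_le_trans _ _ 1)// lerNr -ler_expR lnK ?posrE// ltW.
Qed.

(* Cut off at lam < 1 / e, where the domination holds, so that every term of a
   sequence tending to 0 is scaled_fiber_integral_cvg. *)
Let scaled_fiber lam y : \bar R :=
  if lam < expR (-1) then (fiber lam y * ((scale lam)^-1)%:E)%E else 0%E.

(** Dominated convergence works along sequences, and the right-hand limit is recovered from all
    sequences of positive numbers tending to 0. Integrability of the limit comes out of the same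
    application. *)
Lemma scaled_fiber_integral_cvg (u : nat -> R) :
  (forall i, 0 < u i) -> u i @[i --> \oo] --> (0 : R) ->
  (lebesgue_rV n).-integrable setT (EFin \o limit_density) /\
  (\int[lebesgue_rV n]_y scaled_fiber (u i) y @[i --> \oo] -->
   \int[lebesgue_rV n]_y (limit_density y)%:E)%E.
Proof.
move=> u0 ucvg.
have [] := @dominated_convergence _ _ R (lebesgue_rV n) setT measurableT
  (fun i => scaled_fiber (u i)) (EFin \o limit_density) (EFin \o dominator).
- move=> i; rewrite /scaled_fiber; case: (u i < expR (-1)) => //.
  by apply: emeasurable_funM => //; exact: measurable_fiber.
- by apply/measurable_EFinP; exact: measurable_limit_density.
- apply: filterS ae_generic => y [y0 Zy] _.
  have /cvg_at_rightP/(_ u) hF := fiber_cvg y0 Zy.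
  have {}hF := hF (conj u0 ucvg).
  have e1 : \forall i \near \oo, u i < expR (-1).
    by apply: (cvgr_lt _ ucvg); exact: expR_gt0.
  have h : (fine (fiber (u i) y) / scale (u i))%:E @[i --> \oo] --> (EFin \o limit_density) y.
    by apply/cvg_EFin; [exact: nearW|exact: hF].
  apply: cvg_trans h; apply: near_eq_cvg; near=> i.
  have ui : u i < expR (-1) by near: i.
  rewrite /scaled_fiber ui EFinM fineK// ge0_fin_numE ?fiber_ge0//.
  by rewrite (le_lt_trans (fiber_le y0 (u0 i) ui))// ltry.
- exact: dominator_integrable.
- apply: filterS ae_generic => y [y0 Zy] i _; rewrite /scaled_fiber.
  case: ifPn => ui; last first.
    rewrite abse0 lee_fin mulr_ge0 ?dom_cst_ge0// prodr_ge0// => j _.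
    exact: trunc_pow_ge0.
  have N0 := scale_gt0 (u0 i) ui.
  rewrite gee0_abs; last by rewrite mule_ge0 ?fiber_ge0// lee_fin invr_ge0 ltW.
  by rewrite lee_pdivrMr// muleC; exact: fiber_le.
- by move=> iT _ hT; split.
Unshelve. all: end_near. Qed.

Lemma limit_density_integrable : (lebesgue_rV n).-integrable setT (EFin \o limit_density).
Proof.
(* Any positive sequence tending to 0 serves; here it is 1 / (i + 1). *)
have u0 (i : nat) : 0 < (i.+1%:R^-1 : R) by rewrite invr_gt0.
by have [] := scaled_fiber_integral_cvg u0 cvg_harmonic.
Qed.

Lemma integral_fiber lam :
  (\int[lebesgue_rV n]_y fiber lam y =
   \int[lebesgue_rV (m.+1 + n)]_(w in level_set lam) (phi w)%:E)%E.
Proof.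
rewrite [RHS]integral_mkcond ge0_integral_row_mx2//.
- exact: measurable_phi_lev.
- exact: phi_lev_ge0.
Qed.

Lemma level_volume_cvg :
  (\int[lebesgue_rV (m.+1 + n)]_(w in level_set lam) phi w) / scale lam
    @[lam --> 0^'+] --> \int[lebesgue_rV n]_y limit_density y.
Proof.
pose W lam := if lam < expR (-1) then
  (\int[lebesgue_rV (m.+1 + n)]_(w in level_set lam) phi w) / scale lam else 0.
suff h : W lam @[lam --> (0 : R)^'+] --> \int[lebesgue_rV n]_y limit_density y.
  apply: cvg_trans h; apply: near_eq_cvg; near=> lam.
  rewrite /W ifT//; near: lam; apply: nbhs_right_lt; exact: expR_gt0.
apply/cvg_at_rightP => u [u0 ucvg].
have [_ h] := scaled_fiber_integral_cvg u0 ucvg.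
have WE i : W (u i) = fine (\int[lebesgue_rV n]_y scaled_fiber (u i) y)%E.
  rewrite /W /scaled_fiber; case: ifPn => ui; last by rewrite integral0.
  rewrite ge0_integralZr//; last 3 first.
  - exact: measurable_fiber.
  - by move=> y _; exact: fiber_ge0.
  - by rewrite lee_fin invr_ge0 ltW// scale_gt0.
  rewrite integral_fiber /Rintegral.
  have [fi|] := boolP (\int[lebesgue_rV (m.+1 + n)]_(w in level_set (u i))
      (phi w)%:E \is a fin_num)%E.
    by rewrite fineM.
  (* If the integral is +oo, [fine] returns 0 on both sides, so the identity still holds. *)
  rewrite -integral_fiber ge0_fin_numE -?leNgt ?leye_eq; last first.
    by apply: integral_ge0 => y _; exact: fiber_ge0.
  by move=> /eqP ->; rewrite mulyr gtr0_sg ?invr_gt0 ?scale_gt0// mul1e /= mul0r.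
under eq_fun do rewrite WE.
apply: fine_cvg; rewrite /Rintegral fineK; first exact: h.
exact: (integrable_fin_num measurableT limit_density_integrable).
Unshelve. all: end_near. Qed.

End core.

(** * The asymptotic formula *)

Lemma cube_lty (R : realType) n (A : set 'rV[R]_n) (B : R) : measurable A -> 0 < B ->
  (forall w, A w -> forall i, `|w ord0 i| <= B) -> (lebesgue_rV n A < +oo)%E.
Proof.
move=> mA B0 AB.
have AS : A `<=` box_hyp B (B ^+ n).
  move=> w Aw; split; first exact: AB.
  by apply: box_hyp_large (AB _ Aw).
have mb := @measurable_box_hyp R n B (B ^+ n).
have h : (lebesgue_rV n (@box_hyp R n B (B ^+ n)) < +oo)%E.
  by rewrite lebesgue_box_hyp ?exprn_gt0// ltry.
by apply: le_lt_trans h; apply: le_measure; rewrite ?inE.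
Qed.

Theorem theorem8p5 (R : realType) (m n : nat) (Omega : set 'rV[R]_(m + n))
    (f g phi : 'rV[R]_(m + n) -> R) (kappa : 'I_(m + n) -> nat) (ell : R)
    (m_gt0 : (0 < m)%N)
    (Omega_compact : compact Omega)
    (Omega_fulldim : Omega° !=set0)
    (Omega_semianalytic : semianalytic Omega)
    (g_analytic : real_analytic_on Omega g)
    (g_gt0 : forall w, Omega w -> 0 < g w)
    (phi_analytic : real_analytic_on Omega phi)
    (phi_gt0 : forall w, Omega w -> 0 < phi w)
    (fE : forall w, Omega w -> f w = (\prod_i w ord0 i ^+ kappa i) * g w)
    (ell_gt0 : 0 < ell)
    (kappa_first : forall i : 'I_m, (kappa (lshift n i))%:R = ell^-1)
    (kappa_last : forall j : 'I_n, (kappa (rshift m j))%:R < ell^-1)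
    (kappa_noninc : forall j1 j2 : 'I_n, (j1 <= j2)%N ->
      (kappa (rshift m j2) <= kappa (rshift m j1))%N)
    (Omega_transversal : boundary_transversal Omega (first_coords0 m n)) :
  let V := fun lambda : R =>
    \int[lebesgue_rV (m + n)]_(w in [set w | Omega w /\ `|f w| <= lambda])
      phi w in
  let slice := [set v : 'rV[R]_n | Omega (row_mx 0 v)] in
  let density := fun v : 'rV[R]_n =>
    (\prod_(j < n) `|v ord0 j| `^ (- (ell * (kappa (rshift m j))%:R))) *
    g (row_mx 0 v) `^ (- ell) * phi (row_mx 0 v) in
  let C := (2 * ell) ^+ m / (ell * (m.-1)`!%:R) *
    \int[lebesgue_rV n]_(v in slice) density v in
  [/\ forall lambda : R, (lebesgue_rV (m + n)).-integrable
        [set w | Omega w /\ `|f w| <= lambda] (EFin \o phi),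
      (lebesgue_rV n).-integrable slice (EFin \o density)
    & V = (fun lambda => C * (lambda `^ ell * (- ln lambda) ^+ m.-1))
          +o_ (0^'+) (fun lambda => lambda `^ ell * (- ln lambda) ^+ m.-1)].
Proof.
destruct m as [|m]; first by [].
move=> V slice density C.
have cO : closed Omega by exact: compact_closed Omega_compact.
have mO := closed_measurable_rV cO.
have [B B1 OB] := compact_rV_bounded Omega_compact.
have B0 : 0 < B by exact: lt_le_trans B1.
have [M M0 hM] := compact_continuous_bounded Omega_compact
  (real_analytic_on_continuous phi_analytic).
(* An upper bound of 1 / g on the compact set gives the positive lower bound 1 / g1 of [g]. *)
have [g1 g10 hg1] : exists2 g1 : R, 0 < g1 & forall w, Omega w -> `|(g w)^-1| <= g1.
  apply: compact_continuous_bounded => //.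
  have /subspace_continuousP cg := real_analytic_on_continuous g_analytic.
  apply/subspace_continuousP => w Ow; apply: cvgV; last exact: cg.
  by rewrite gt_eqF// g_gt0.
have g0_gt0 : 0 < g1^-1 by rewrite invr_gt0.
have g_ge w : Omega w -> g1^-1 <= g w.
  move=> Ow; have gw := g_gt0 _ Ow.
  rewrite -[leRHS]invrK lef_pV2 ?posrE ?invr_gt0//.
  by rewrite (le_trans _ (hg1 w Ow))// ler_norm.
have phi_le w : Omega w -> phi w <= M.
  by move=> Ow; rewrite (le_trans (ler_norm _))// hM.
have phi_ge0 w : Omega w -> 0 <= phi w by move=> /phi_gt0/ltW.
have mg := real_analytic_on_measurable mO g_analytic.
have mphi := real_analytic_on_measurable mO phi_analytic.
pose Z := [set v : 'rV[R]_n | boundary Omega (row_mx (0 : 'rV[R]_m.+1) v)].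
have mZ : measurable Z.
  apply: measurable_slice; exact: measurable_boundary.
have Z0 : lebesgue_rV n Z = 0%E by exact: boundary_slice_null.
have ZP y : ~ Z y -> Omega (row_mx 0 y) -> Omega° (row_mx 0 y).
  move=> Zy Oy; apply: contrapT => Iy; apply: Zy.
  by split=> //; exact: subset_closure.
have cphi y : ~ Z y -> {for row_mx 0 y, continuous (phi \_ Omega)%R}.
  move=> /ZP Zy; have [/Zy Oy|Oy] := pselect (Omega (row_mx 0 y)).
    by apply: restrict_continuous_interior => //; exact: real_analytic_on_interior phi_analytic _.
  exact: restrict_continuous_exterior.
have cg y : ~ Z y ->
    {for row_mx 0 y, continuous ((fun w => g w `^ (- ell)) \_ Omega)%R}.
  move=> /ZP Zy; have [Oy|Oy] := pselect (Omega (row_mx 0 y)).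
    apply: restrict_continuous_interior; last exact: Zy.
    apply: (@continuous_comp _ _ _ g (fun r => r `^ (- ell))).
      by apply: real_analytic_on_interior g_analytic _; exact: Zy.
    by apply: continuous_powR; exact: g_gt0.
  exact: restrict_continuous_exterior.
have mlev := @measurable_level_set R m n Omega f g kappa mO mg fE.
have hcvg := @level_volume_cvg R m n Omega f g phi kappa ell B M g1^-1 Z ell_gt0
  kappa_first kappa_last mO B1 OB mg mphi g0_gt0 g_ge M0 phi_le phi_ge0 fE mZ Z0 cg cphi.
have hint := @limit_density_integrable R m n Omega f g phi kappa ell B M g1^-1 Z ell_gt0
  kappa_first kappa_last mO B1 OB mg mphi g0_gt0 g_ge M0 phi_le phi_ge0 fE mZ Z0 cg cphi.
set T := (X in EFin \o X) in hint.
(* The ratio between the limit of the fibers and the stated density; it equals (2 ell)^(m+1) / (ell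
   m!). Being nonzero, it also carries integrability over to the stated density. *)
pose c := ell ^+ m * (2 ^+ m.+1 / m`!%:R).
have c_gt0 : 0 < c by rewrite mulr_gt0 ?exprn_gt0// divr_gt0 ?exprn_gt0// ltr0n fact_gt0.
have TE : T = (fun y => c * (density \_ slice) y).
  apply/funext => y; rewrite /T /c /patch.
  have -> : (y \in slice) = (row_mx 0 y \in Omega).
    by apply/idP/idP => /set_mem h; exact/mem_set.
  by case: ifP => _; rewrite ?mulr0// /density.
have dint : (lebesgue_rV n).-integrable setT (EFin \o (density \_ slice)).
  have := @integrableZl _ _ R (lebesgue_rV n) setT measurableT c^-1 _ hint.
  apply: eq_integrable => // y _.
  by rewrite /= TE -EFinM mulrA mulVf ?gt_eqF// mul1r.
have mslice : measurable slice by exact: measurable_slice.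
have sint : (lebesgue_rV n).-integrable slice (EFin \o density).
  apply/(integrable_mkcond _ mslice); apply: eq_integrable dint => // y _.
  by rewrite /= /patch; case: ifP.
split=> //.
- move=> lambda; apply: measurable_bounded_integrable.
  + exact: mlev.
  + by apply: (cube_lty (mlev lambda) B0) => w [Ow _]; exact: OB.
  + by apply: measurable_funS mphi => // w [].
  + exists M; split; rewrite ?num_real// => N MN w [Ow _] /=.
    by rewrite (le_trans (hM _ Ow))// ltW.
- have CE : \int[lebesgue_rV n]_y T y = C.
    rewrite TE RintegralZl// /C -Rintegral_mkcond.
    congr (_ * _); rewrite /c /= exprMn [ell ^+ m.+1]exprS; field.
    by rewrite !gt_eqF// ltr0n fact_gt0.
  (* The little-o is the convergence of the quotient multiplied back by the scale, which is positive
     for 0 < lam < 1. *)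
  apply/eqaddoP => eps eps0.
  rewrite CE in hcvg.
  move/cvgrPdist_le : hcvg => /(_ _ eps0) hcvg.
  near=> lam.
  have l0 : 0 < lam by [].
  have N0 : 0 < lam `^ ell * (- ln lam) ^+ m.
    rewrite mulr_gt0 ?powR_gt0// exprn_gt0// oppr_gt0 ln_lt0// l0/=.
    by near: lam; exact: nbhs_right_lt.
  rewrite !fctE [X in _ <= _ * X]gtr0_norm//.
  have -> : V lam - C * (lam `^ ell * (- ln lam) ^+ m) =
      (V lam / (lam `^ ell * (- ln lam) ^+ m) - C) * (lam `^ ell * (- ln lam) ^+ m).
    by rewrite mulrBl divfK// gt_eqF.
  rewrite normrM [X in _ * X <= _]gtr0_norm// ler_wpM2r ?(ltW N0)// distrC.
  by near: lam.
Unshelve. all: end_near. Qed.
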